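(* Let $\Gamma$ be a countable group and let $\bm{\iota}$ denote the identity action of $\Gamma$ on a standard non-atomic probability space. If $\bm{b}$ is a measure preserving action of $\Gamma$ that is strongly ergodic, then $\bm{\iota}\times\bm{b}$ is not weakly equivalent to any ergodic measure preserving action of $\Gamma$. In particular, if $\Gamma$ is non-amenable and $\bm{s}_\Gamma=\Gamma\curvearrowright^{s_\Gamma}([0,1]^\Gamma,\lambda^\Gamma)$ is the Bernoulli shift action of $\Gamma$ (where $\lambda$ is Lebesgue measure on $[0,1]$), then $\bm{\iota}\times\bm{s}_\Gamma$ is a free action of $\Gamma$ that is not weakly equivalent to any ergodic action.
   Context: A measure preserving action $\bm{a}=\Gamma\curvearrowright^a(X,\mu)$ of a countable group $\Gamma$ is a Borel action $a$ of $\Gamma$ on a standard Borel space $X$ preserving a Borel probability measure $\mu$ on $X$; write $\gamma^a x$ for the action of $\gamma$ on $x$. It is free if $\mu$-almost every point has trivial stabilizer. Weak containment: for $\bm{a}$ on $(X,\mu)$ and $\bm{b}$ on $(Y,\nu)$, $\bm{a}\prec\bm{b}$ means that for every finite Borel partition $A_0,\dots,A_{k-1}$ of $X$, every finite $F\subseteq\Gamma$, and every $\epsilon>0$ there is a Borel partition $B_0,\dots,B_{k-1}$ of $Y$ with $|\mu(\gamma^aA_i\cap A_j)-\nu(\gamma^bB_i\cap B_j)|<\epsilon$ for all $\gamma\in F$ and $i,j<k$. $\bm{a}$ and $\bm{b}$ are weakly equivalent, $\bm{a}\sim\bm{b}$, if $\bm{a}\prec\bm{b}$ and $\bm{b}\prec\bm{a}$.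 A measure preserving action $\bm{b}=\Gamma\curvearrowright^b(Y,\nu)$ is strongly ergodic if for every sequence of Borel sets $A_n\subseteq Y$ with $\nu(\gamma^bA_n\triangle A_n)\to0$ for all $\gamma\in\Gamma$ (an asymptotically invariant sequence) one has $\nu(A_n)(1-\nu(A_n))\to0$. The shift action is $(\gamma\cdot f)(\delta)=f(\gamma^{-1}\delta)$. Products of actions are diagonal actions with product measure. *)

(* Defs.v *)
From HB Require Import structures.
From mathcomp Require Import all_boot all_order all_algebra.
From mathcomp Require Import all_classical all_reals all_analysis.
From mathcomp Require Import measurable_realfun.
From mathcomp Require Import ring lra zify.

Set Implicit Arguments.
Unset Strict Implicit.
Unset Printing Implicit Defensive.
Import Order.TTheory GRing.Theory Num.Theory.
Import numFieldNormedType.Exports.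
Local Open Scope classical_set_scope.
Local Open Scope ring_scope.

Section standard_borel.
Context {R : realType}.

Definition is_metric (T : Type) (dist : T -> T -> R) : Prop :=
  [/\ forall x y, dist x y = 0 <-> x = y,
      forall x y, dist x y = dist y x
    & forall x y z, dist x z <= dist x y + dist y z].

Definition metric_complete (T : Type) (dist : T -> T -> R) : Prop :=
  forall u : nat -> T,
    (forall e, 0 < e ->
       exists N, forall m n, (N <= m)%N -> (N <= n)%N -> dist (u m) (u n) < e) ->
    exists l, forall e, 0 < e ->
       exists N, forall n, (N <= n)%N -> dist (u n) l < e.

(* All measurable types are nonempty, so a countable dense set may be given by
   a sequence. *)
Definition metric_separable (T : Type) (dist : T -> T -> R) : Prop :=
  exists s : nat -> T, forall x e, 0 < e -> exists n, dist x (s n) < e.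

Definition metric_open (T : Type) (dist : T -> T -> R) : set (set T) :=
  [set U | forall x, U x ->
     exists2 e, 0 < e & [set y | dist x y < e] `<=` U].

Definition standard_borel d (T : measurableType d) : Prop :=
  exists dist : T -> T -> R,
    [/\ is_metric dist, metric_complete dist, metric_separable dist
      & @measurable d T = <<s metric_open dist >>].

End standard_borel.

Section standard_borel_facts.
Context {R : realType}.

Lemma is_metric_ge0 T (dist : T -> T -> R) : is_metric dist ->
  forall x y, 0 <= dist x y.
Proof.
move=> [d0 ds dt] x y.
have := dt x y x; rewrite (ds y x) (d0 x x).2// -mulr2n.
by rewrite pmulrn_lge0.
Qed.

Lemma metric_closed_ball_borel T (dist : T -> T -> R) x e : is_metric dist ->
  <<s metric_open dist >> [set y | dist x y <= e].
Proof.
move=> [_ ds dt].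
rewrite (_ : [set _ | _] = setT `\` [set y | e < dist x y]); last first.
  apply/seteqP; split => y /=; rewrite leNgt; first by move=> /negP.
  by move=> [_ /negP].
apply: sigma_algebraCD; apply: sub_sigma_algebra => y /= ey.
exists (dist x y - e); first by rewrite subr_gt0.
move=> z /=; have := dt x z y; rewrite (ds z y); lra.
Qed.

Lemma metric_open_measurable d (T : measurableType d) (dist : T -> T -> R) :
  is_metric dist -> metric_separable dist ->
  (forall x e, measurable [set y | dist x y <= e]) ->
  metric_open dist `<=` measurable.
Proof.
move=> [_ ds dt] [s sP] mball U oU.
pose B (k : nat * nat) := [set y | dist (s k.1) y <= k.2.+1%:R^-1].
pose F k := if `[< B k `<=` U >] then B k else set0.
rewrite (_ : U = \bigcup_(n : nat) (if unpickle n is Some k then F k else set0)).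
  apply: bigcupT_measurable => n; case: unpickle => // k.
  by rewrite /F; case: ifP => // _; exact: mball.
apply/seteqP; split => [x Ux|x [n _]]; last first.
  by case: unpickle => // k; rewrite /F; case: ifP => // /asboolP; apply.
have [e e0 eU] := oU x Ux.
have [m] := ltr_add_invr (divr_gt0 e0 (ltr0n R 2)).
rewrite add0r => me.
have [n xn] := sP x m.+1%:R^-1 ltac:(by rewrite invr_gt0 ltr0n).
exists (pickle (n, m)) => //; rewrite pickleK /F asboolT; last first.
  move=> y /= ny; apply: eU => /=; apply: le_lt_trans (dt x (s n) y) _.
  by rewrite [ltRHS](splitr e) ltrD// ?(lt_trans xn)// (le_lt_trans ny).
by rewrite /B /= ds ltW.
Qed.

Lemma preimage_generated T1 T2 (G1 : set (set T1)) (G2 : set (set T2))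
  (f : T1 -> T2) :
  (forall A, G2 A -> <<s G1 >> (f @^-1` A)) ->
  forall A, <<s G2 >> A -> <<s G1 >> (f @^-1` A).
Proof.
move=> h A sA.
suff : <<s G2 >> `<=` [set B | <<s G1 >> (f @^-1` B)] by apply.
apply: smallest_sub => //; split => /=.
- by rewrite preimage_set0; exact: sigma_algebra0.
- by move=> B sB; rewrite setTD preimage_setC -setTD; exact: sigma_algebraCD.
- by move=> F sF; rewrite preimage_bigcup; exact: sigma_algebra_bigcup.
Qed.

Lemma standard_borel_prod d1 d2 (T1 : measurableType d1)
  (T2 : measurableType d2) :
  standard_borel (R := R) T1 -> standard_borel (R := R) T2 ->
  standard_borel (R := R) (T1 * T2)%type.
Proof.
move=> [d [dm dc [s ds] dE]] [d' [dm' dc' [s' ds'] dE']].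
have [d0 dsym dt] := dm; have [d0' dsym' dt'] := dm'.
pose D (x y : T1 * T2) : R := Num.max (d x.1 y.1) (d' x.2 y.2).
have DP x y e : (D x y < e) = (d x.1 y.1 < e) && (d' x.2 y.2 < e).
  by rewrite /D gt_max.
have DPle x y e : (D x y <= e) = (d x.1 y.1 <= e) && (d' x.2 y.2 <= e).
  by rewrite /D ge_max.
have Dm : is_metric D.
  split => [[x x'] [y y']|x y|x y z].
  - split => [Dxy|[-> ->]]; last first.
      by rewrite /D /= (d0 _ _).2// (d0' _ _).2// maxxx.
    have : D (x, x') (y, y') <= 0 by rewrite Dxy.
    rewrite DPle /= => /andP[h1 h2].
    have -> : x = y.
      by apply/d0/eqP; rewrite eq_le h1 is_metric_ge0.
    by have -> : x' = y' by apply/d0'/eqP; rewrite eq_le h2 is_metric_ge0.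
  - by rewrite /D dsym dsym'.
  - rewrite DPle; apply/andP; split.
      apply: (le_trans (dt _ y.1 _)); rewrite lerD// /D le_max lexx//.
    by apply: (le_trans (dt' _ y.2 _)); rewrite lerD// /D le_max lexx orbT.
have Dsep : metric_separable D.
  exists (fun n => if unpickle n is Some k then (s k.1, s' k.2) else (s 0%N, s' 0%N)).
  move=> x e e0; have [n nP] := ds x.1 e e0; have [m mP] := ds' x.2 e e0.
  by exists (pickle (n, m)); rewrite pickleK DP /= nP.
exists D; split => //.
- move=> u uC.
  have [|l1 l1P] := dc (fst \o u).
    move=> e /uC[N NP]; exists N => m n Nm Nn.
    by have := NP m n Nm Nn; rewrite DP => /andP[].
  have [|l2 l2P] := dc' (snd \o u).
    move=> e /uC[N NP]; exists N => m n Nm Nn.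
    by have := NP m n Nm Nn; rewrite DP => /andP[].
  exists (l1, l2) => e e0; have [N NP] := l1P e e0; have [M MP] := l2P e e0.
  exists (maxn N M) => n; rewrite geq_max => /andP[Nn Mn].
  by rewrite DP /= (NP _ Nn) (MP _ Mn).
- apply/seteqP; split; last first.
    apply: smallest_sub; first exact: sigma_algebra_measurable.
    apply: metric_open_measurable => // x e.
    rewrite (_ : [set _ | _] =
      [set y | d x.1 y <= e] `*` [set y | d' x.2 y <= e]); last first.
      by apply/seteqP; split => y /=; rewrite DPle => /andP.
    by apply: measurableX; rewrite ?dE ?dE'; exact: metric_closed_ball_borel.
  apply: smallest_sub; first exact: smallest_sigma_algebra.
  move=> A [] [B]; [rewrite dE|rewrite dE'] => mB <-; rewrite setTI;
      move: B mB; apply: preimage_generated => U oU;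
      apply: sub_sigma_algebra => x /= /oU[e e0 eU]; exists e => // y /=;
      by rewrite DP => /andP[? ?]; exact: eU.
Qed.

End standard_borel_facts.

Record std_prob_space (R : realType) := StdProbSpace {
  sps_display : measure_display;
  sps_carrier :> measurableType sps_display;
  sps_prob : probability sps_carrier R;
  sps_standard : standard_borel (R := R) sps_carrier
}.

(* No atoms; on a standard Borel space this means that points are null. *)
Definition nonatomic (R : realType) (X : std_prob_space R) : Prop :=
  forall A : set X, measurable A -> (0 < sps_prob X A)%E ->
    exists B : set X, [/\ measurable B, B `<=` A,
      (0 < sps_prob X B)%E & (sps_prob X B < sps_prob X A)%E].

Record pmp_action (R : realType) (Gamma : groupType) := PmpAction {
  pmp_space :> std_prob_space R;
  act : Gamma -> pmp_space -> pmp_space;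
  act_1 : forall x, act 1%g x = x;
  act_M : forall g h x, act (g * h)%g x = act g (act h x);
  act_measurable : forall g, measurable_fun setT (act g);
  act_preserving : forall g (A : set pmp_space), measurable A ->
    sps_prob pmp_space (act g @^-1` A) = sps_prob pmp_space A
}.

Arguments act {R Gamma} _ _ _.

Section pmp_properties.
Context {R : realType} {Gamma : groupType}.
Implicit Types a b : pmp_action R Gamma.

Definition pmp_free a : Prop :=
  {ae sps_prob a, forall x, forall g, act a g x = x -> g = 1%g}.

Definition ergodic a : Prop :=
  forall A : set a, measurable A -> (forall g, act a g @` A = A) ->
    sps_prob a A = 0%E \/ sps_prob a A = 1%E.

Definition strongly_ergodic a : Prop :=
  forall A : nat -> set a, (forall n, measurable (A n)) ->
    (forall g,
       (fun n => sps_prob a ((act a g @` A n) `+` A n)) @ \oo --> 0%E) ->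
    (fun n => sps_prob a (A n) * (1 - sps_prob a (A n)))%E @ \oo --> 0%E.

Definition borel_partition a (k : nat) (A : 'I_k -> set a) : Prop :=
  [/\ forall i, measurable (A i), trivIset setT A & \bigcup_i A i = setT].

Definition weakly_contained a b : Prop :=
  forall (k : nat) (A : 'I_k -> set a), borel_partition A ->
  forall F : set Gamma, finite_set F -> forall e : R, 0 < e ->
  exists2 B : 'I_k -> set b, borel_partition B &
    forall g i j, F g ->
      (`| sps_prob a ((act a g @` A i) `&` A j)
          - sps_prob b ((act b g @` B i) `&` B j) | < e%:E)%E.

Definition weakly_equivalent a b : Prop :=
  weakly_contained a b /\ weakly_contained b a.

End pmp_properties.

Definition identity_action (R : realType) (Gamma : groupType)
  (X : std_prob_space R) : pmp_action R Gamma :=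
  @PmpAction R Gamma X (fun _ x => x) (fun _ => erefl) (fun _ _ _ => erefl)
    (fun _ => @measurable_id _ X setT) (fun _ _ _ => erefl).

Definition prod_space (R : realType) (X Y : std_prob_space R) :
    std_prob_space R :=
  StdProbSpace (sps_prob X \x sps_prob Y)%E
    (standard_borel_prod (sps_standard X) (sps_standard Y)).

Section prod_action.
Context {R : realType} {Gamma : groupType} (a b : pmp_action R Gamma).

Let pact (g : Gamma) (z : prod_space a b) : prod_space a b :=
  (act a g z.1, act b g z.2).

Let pact_1 z : pact 1%g z = z.
Proof. by rewrite /pact !act_1 -surjective_pairing. Qed.

Let pact_M g h z : pact (g * h)%g z = pact g (pact h z).
Proof. by rewrite /pact !act_M. Qed.

Let pact_measurable g : measurable_fun setT (pact g).
Proof.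
apply/measurable_fun_pair.
- by apply: measurableT_comp; [exact: act_measurable|exact: measurable_fst].
- by apply: measurableT_comp; [exact: act_measurable|exact: measurable_snd].
Qed.

Let pact_preserving g (A : set (prod_space a b)) : measurable A ->
  sps_prob (prod_space a b) (pact g @^-1` A) = sps_prob (prod_space a b) A.
Proof.
move=> mA; apply/esym.
have [h hE] : exists h : {mfun (a * b)%type >-> (a * b)%type},
    h = pact g :> (_ -> _).
  by exists (mfun_Sub (mem_set (pact_measurable g))).
transitivity (pushforward (sps_prob a \x sps_prob b)%E h A); last first.
  by rewrite /pushforward hE.
apply: (@product_measure_unique _ _ a b R (sps_prob a) (sps_prob b)
  (pushforward (sps_prob a \x sps_prob b)%E h)) => // B C mB mC.
have mgB : measurable (act a g @^-1` B).
  by rewrite -[X in measurable X]setTI; exact: act_measurable.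
have mgC : measurable (act b g @^-1` C).
  by rewrite -[X in measurable X]setTI; exact: act_measurable.
change ((sps_prob a \x sps_prob b) (h @^-1` (B `*` C)) =
  sps_prob a B * sps_prob b C)%E.
rewrite hE (_ : pact g @^-1` (B `*` C) =
  (act a g @^-1` B) `*` (act b g @^-1` C))//.
rewrite product_measure1E//.
by congr (_ * _)%E; exact: act_preserving.
Qed.

Definition prod_action : pmp_action R Gamma :=
  PmpAction pact_1 pact_M pact_measurable pact_preserving.

End prod_action.

Definition amenable (R : realType) (Gamma : groupType) : Prop :=
  exists m : set Gamma -> R,
    [/\ forall A, 0 <= m A,
        m setT = 1,
        forall A B, A `&` B = set0 -> m (A `|` B) = m A + m B
      & forall g A, m [set (g * h)%g | h in A] = m A].

(* Existence of the product of Lebesgue measures. Separating the binary digits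
   of even and odd rank gives measurable maps [split_fst] and [split_snd] such
   that x |-> (split_fst x, split_snd x) carries the uniform measure on [0, 1]
   to its square; then the functions split_fst (split_snd^n x) are independent
   and uniformly distributed. *)
Section deinterleave.

(* [even_bits n q] and [odd_bits n q] are the numbers whose [n] binary digits
   are the digits of rank 2k+1, respectively 2k, of [q]. *)
Fixpoint even_bits n q : nat :=
  if n is m.+1 then (2 * even_bits m (q %/ 4) + q %% 4 %/ 2)%N else 0%N.
Fixpoint odd_bits n q : nat :=
  if n is m.+1 then (2 * odd_bits m (q %/ 4) + q %% 2)%N else 0%N.
Fixpoint interleave n i j : nat :=
  if n is m.+1 then
    (4 * interleave m (i %/ 2) (j %/ 2) + 2 * (i %% 2) + j %% 2)%N
  else 0%N.

Lemma even_bits_lt n q : (even_bits n q < 2 ^ n)%N.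
Proof.
elim: n q => [//|n IH] q /=; rewrite expnS.
by have := IH (q %/ 4)%N; lia.
Qed.

Lemma odd_bits_lt n q : (odd_bits n q < 2 ^ n)%N.
Proof.
elim: n q => [//|n IH] q /=; rewrite expnS.
by have := IH (q %/ 4)%N; lia.
Qed.

Lemma interleave_lt n i j : (interleave n i j < 4 ^ n)%N.
Proof.
elim: n i j => [//|n IH] i j /=; rewrite expnS.
by have := IH (i %/ 2)%N (j %/ 2)%N; lia.
Qed.

Lemma even_bitsK n i j : (i < 2 ^ n)%N -> even_bits n (interleave n i j) = i.
Proof.
elim: n i j => [|n IH] i j /=; first by case: i.
rewrite expnS => hi.
set r := interleave n _ _.
have -> : ((4 * r + 2 * (i %% 2) + j %% 2) %/ 4 = r)%N by lia.
by rewrite IH; lia.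
Qed.

Lemma odd_bitsK n i j : (j < 2 ^ n)%N -> odd_bits n (interleave n i j) = j.
Proof.
elim: n i j => [|n IH] i j /=; first by case: j.
rewrite expnS => hi.
set r := interleave n _ _.
have -> : ((4 * r + 2 * (i %% 2) + j %% 2) %/ 4 = r)%N by lia.
by rewrite IH; lia.
Qed.

Lemma interleaveK n q : (q < 4 ^ n)%N ->
  interleave n (even_bits n q) (odd_bits n q) = q.
Proof.
elim: n q => [|n IH] q /=; first by case: q.
rewrite expnS => hq.
have -> : ((2 * even_bits n (q %/ 4) + q %% 4 %/ 2) %/ 2 = even_bits n (q %/ 4))%N by lia.
have -> : ((2 * odd_bits n (q %/ 4) + q %% 2) %/ 2 = odd_bits n (q %/ 4))%N by lia.
rewrite IH; lia.
Qed.

End deinterleave.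

Section split_uniform.
Context {R : realType}.
Local Notation P := (uniform_prob (@ltr01 R)).

Lemma uniform01E (A : set R) : measurable A ->
  P A = lebesgue_measure (A `&` `[0, 1]).
Proof.
move=> mA; rewrite /uniform_prob integral_uniform_pdf.
rewrite (eq_integral (fun=> 1%E)).
  by rewrite integral_cst ?mul1e//; exact: measurableI.
move=> x; rewrite inE => -[_]; rewrite /= in_itv /= /uniform_pdf => ->.
by rewrite subr0 invr1.
Qed.

Lemma measurable_fun_to_nat d (T : measurableType d) (f : T -> nat) :
  (forall q, measurable [set x | f x = q]) -> measurable_fun setT f.
Proof.
move=> mf _ B _; rewrite setTI.
rewrite (_ : f @^-1` B = \bigcup_q (if `[< B q >] then [set x | f x = q] else set0)).
  by apply: bigcupT_measurable => q; case: ifP.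
apply/seteqP; split => [x Bfx|x [q _]].
  by exists (f x) => //; rewrite asboolT.
by case: ifP => // /asboolP Bq /= fxq; rewrite fxq.
Qed.

Definition quad_digits n (x : R) : nat := Num.truncn (4 ^+ n * x).

Lemma quad_digitsS n x : (quad_digits n.+1 x %/ 4 = quad_digits n x)%N.
Proof.
rewrite /quad_digits exprS; set y := 4 ^+ n * x.
have -> : 4 * 4 ^+ n * x = 4 * y by rewrite /y mulrA.
have [y0|y0] := leP 0 y; last first.
  have /eqP-> : Num.truncn y == 0%N by rewrite -leqn0 truncn_le_nat; lra.
  have /eqP-> // : Num.truncn (4 * y) == 0%N by rewrite -leqn0 truncn_le_nat; lra.
apply/esym/eqP; rewrite truncn_eq//.
have y40 : 0 <= 4 * y by lra.
have /andP[] := truncn_itv y40; set q := Num.truncn _ => h1 h2.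
have h3 : ((4 * (q %/ 4))%N%:R : R) <= q%:R by rewrite ler_nat; lia.
have h4 : (q.+1%:R : R) <= (4 * (q %/ 4).+1)%N%:R by rewrite ler_nat; lia.
move: h3 h4; rewrite !natrM; lra.
Qed.

Lemma quad_digits_set n q : [set x | quad_digits n x = q] =
  if q is 0 then `]-oo, (4 ^- n)[%classic
  else `[(q%:R / 4 ^+ n), (q.+1%:R / 4 ^+ n)[%classic :> set R.
Proof.
have p0 : 0 < 4 ^+ n :> R by rewrite exprn_gt0.
apply/seteqP; split => x /=.
  rewrite /quad_digits; case: q => [|q] h; rewrite /= in_itv /=.
    rewrite -[ltRHS]mul1r ltr_pdivlMr// mulrC.
    by move: h => /eqP; rewrite -leqn0 truncn_le_nat.
  rewrite ler_pdivrMr// ltr_pdivlMr// mulrC.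
  by rewrite -truncn_gt_nat -truncn_le_nat h !leqnn.
rewrite /quad_digits; case: q => [|q]; rewrite /= in_itv /=.
  rewrite -[ltRHS]mul1r ltr_pdivlMr// mulrC => h.
  by apply/eqP; rewrite -leqn0 truncn_le_nat.
rewrite ler_pdivrMr// ltr_pdivlMr// mulrC.
rewrite -truncn_gt_nat -truncn_le_nat => h; apply/eqP.
by rewrite eqn_leq andbC.
Qed.

Lemma measurable_quad_digits n : measurable_fun setT (quad_digits n).
Proof.
by apply: measurable_fun_to_nat => q; rewrite quad_digits_set; case: q.
Qed.

Lemma quad_digits_prob n q : (q < 4 ^ n)%N ->
  P [set x | quad_digits n x = q] = (4 ^- n)%:E.
Proof.
move=> qn; have p0 : 0 < 4 ^+ n :> R by rewrite exprn_gt0.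
have pE : (4 ^ n)%N%:R = 4 ^+ n :> R by rewrite natrX.
have q1 : q.+1%:R / 4 ^+ n <= 1 :> R.
  by rewrite ler_pdivrMr// mul1r -pE ler_nat.
have q2 : 0 <= q%:R / 4 ^+ n :> R by rewrite divr_ge0// ltW.
have q3 : q%:R / 4 ^+ n < q.+1%:R / 4 ^+ n :> R.
  by rewrite ltr_pM2r ?invr_gt0// ltr_nat.
rewrite uniform01E; last first.
  by rewrite quad_digits_set; case: (q).
rewrite (_ : _ `&` _ = `[(q%:R / 4 ^+ n), (q.+1%:R / 4 ^+ n)[%classic :> set R).
  rewrite lebesgue_measure_itv/= lte_fin q3 -EFinD -mulrBl -natr1.
  by rewrite addrAC subrr add0r mul1r.
rewrite quad_digits_set; case: q qn q1 q2 q3 => [|q] qn q1 q2 q3.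
  rewrite mul1r in q1.
  apply/seteqP; split => x; rewrite /= !in_itv /= mul0r mul1r.
    by move=> [-> /andP[->]].
  by move=> /andP[x0 x1]; rewrite x1 x0 (le_trans (ltW x1)).
apply/seteqP; split => x; rewrite /= !in_itv /=; first by case.
move=> /andP[x0 x1]; rewrite x0 x1; split => //.
by rewrite (le_trans q2)//= (le_trans (ltW x1)).
Qed.

Lemma quad_digits_ge n x : (4 ^ n <= quad_digits n x)%N -> 1 <= x.
Proof.
have p0 : 0 < 4 ^+ n :> R by rewrite exprn_gt0.
rewrite /quad_digits => h.
have : (0 < Num.truncn (4 ^+ n * x))%N by rewrite (leq_trans _ h)// expn_gt0.
rewrite truncn_gt0 => h1.
have := h; rewrite truncn_ge_nat; last by rewrite (le_trans ler01).
by rewrite natrX ler_pMr.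
Qed.

End split_uniform.

Section digit_coordinate.
Context {R : realType}.
Local Notation P := (uniform_prob (@ltr01 R)).
Variable E : nat -> nat -> nat.
Hypothesis E_lt : forall n q, (E n q < 2 ^ n)%N.
Hypothesis E_step : forall n q,
  (2 * E n (q %/ 4) <= E n.+1 q <= 2 * E n (q %/ 4) + 1)%N.

Definition digit_approx n (x : R) : R := (E n (quad_digits n x))%:R / 2 ^+ n.

Definition digit_coordinate (x : R) : R := sup (range (digit_approx ^~ x)).

Let p0 n : 0 < 2 ^+ n :> R.
Proof. by rewrite exprn_gt0. Qed.

Lemma digit_approx_step n x :
  digit_approx n x <= digit_approx n.+1 x /\
  digit_approx n.+1 x + 2 ^- n.+1 <= digit_approx n x + 2 ^- n.
Proof.
have := E_step n (quad_digits n.+1 x); rewrite quad_digitsS => /andP[].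
rewrite /digit_approx; set a := E _ _; set b := E _ _ => h1 h2.
have {}h1 : (2 * a)%N%:R <= b%:R :> R by rewrite ler_nat.
have {}h2 : b%:R <= (2 * a + 1)%N%:R :> R by rewrite ler_nat.
move: h1 h2; rewrite natrD natrM => h1 h2.
rewrite -[X in _ + X <= _]mul1r -[X in _ <= _ + X]mul1r -!mulrDl exprS invfM.
rewrite !(mulrCA _ 2^-1) !(mulrA 2^-1) mulrC [leLHS]mulrC.
by rewrite !ler_pM2r ?invr_gt0//; split; lra.
Qed.

Lemma digit_approx_ge0 n x : 0 <= digit_approx n x.
Proof. by rewrite divr_ge0// ltW. Qed.

Lemma digit_approx_le m n x : (m <= n)%N -> digit_approx m x <= digit_approx n x.
Proof.
elim: n => [|n IH]; first by rewrite leqn0 => /eqP->.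
rewrite leq_eqVlt => /predU1P[->//|]; rewrite ltnS => /IH.
by move=> /le_trans; apply; have [] := digit_approx_step n x.
Qed.

Lemma digit_approx_ub m n x : digit_approx n x <= digit_approx m x + 2 ^- m.
Proof.
have [nm|/ltnW mn] := leqP n m.
  by rewrite (le_trans (digit_approx_le _ nm))// lerDl invr_ge0 ltW.
suff : digit_approx n x + 2 ^- n <= digit_approx m x + 2 ^- m.
  by apply: le_trans; rewrite lerDl invr_ge0 ltW.
elim: n mn => [|n IH]; first by rewrite leqn0 => /eqP->.
rewrite leq_eqVlt => /predU1P[->//|]; rewrite ltnS => /IH.
by apply: le_trans; have [] := digit_approx_step n x.
Qed.

Let has_sup_digit x : has_sup (range (digit_approx ^~ x)).
Proof.
split; first by exists (digit_approx 0 x), 0%N.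
by exists (digit_approx 0 x + 2 ^- 0) => _ [n _ <-]; exact: digit_approx_ub.
Qed.

Lemma digit_coordinate_ge n x : digit_approx n x <= digit_coordinate x.
Proof. by apply: ub_le_sup; [case: (has_sup_digit x)|exists n]. Qed.

Lemma digit_coordinate_le n x : digit_coordinate x <= digit_approx n x + 2 ^- n.
Proof.
apply: ge_sup; first by case: (has_sup_digit x).
by move=> _ [m _ <-]; exact: digit_approx_ub.
Qed.

Lemma digit_coordinate_itv x : 0 <= digit_coordinate x <= 1.
Proof.
rewrite (le_trans (digit_approx_ge0 0 x) (digit_coordinate_ge 0 x)) /=.
apply: (le_trans (digit_coordinate_le 0 x)).
rewrite /digit_approx expr0 !divr1 invr1.
by have := E_lt 0 (quad_digits 0 x); rewrite expn0; case: (E _ _) => //; rewrite add0r.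
Qed.

Lemma measurable_digit_bits n :
  measurable_fun setT (fun x : R => E n (quad_digits n x)).
Proof.
apply: (measurableT_comp (f := E n)) => //; exact: measurable_quad_digits.
Qed.

Lemma measurable_digit_coordinate : measurable_fun setT digit_coordinate.
Proof.
apply: (measurability _ (RGenOInfty.measurableE R)) => _ [_ [c ->] <-].
rewrite setTI.
rewrite (_ : _ @^-1` _ =
    \bigcup_n (fun x => E n (quad_digits n x)) @^-1`
      [set k | c < k%:R / 2 ^+ n :> R]).
  by apply: bigcupT_measurable => n; rewrite -[X in measurable X]setTI;
    exact: measurable_digit_bits.
apply/seteqP; split => x /=; rewrite in_itv /= andbT; last first.
  by move=> [n _ /lt_le_trans]; apply; exact: digit_coordinate_ge.
by move=> /sup_gt[|_ [n _ <-] ?]; [case: (has_sup_digit x)|exists n].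
Qed.

End digit_coordinate.

Section rays.
Context {R : realType}.

Definition rays : set (set R) := [set A | exists x, A = `]-oo, x]%classic].

Lemma measurable_rays : @measurable _ (measurableTypeR R) = <<s rays >>.
Proof.
have -> : @measurable _ (measurableTypeR R) = <<s RGenOInfty.G (R := R)>>.
  exact: RGenOInfty.measurableE.
apply/seteqP; split; apply: smallest_sub; try exact: smallest_sigma_algebra.
  move=> _ [x ->]; rewrite -setCitvl; apply: sigma_algebraC.
  by apply: sub_sigma_algebra; exists x.
move=> _ [x ->]; rewrite -setCitvr; apply: sigma_algebraC.
by apply: sub_sigma_algebra; exists x.
Qed.

Lemma setI_closed_rays : setI_closed rays.
Proof.
move=> _ _ [x ->] [y ->]; exists (Num.min x y).
by apply/seteqP; split => z /=; rewrite !in_itv /= le_min => /andP.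
Qed.

Lemma rays_unique (m1 m2 : {measure set (measurableTypeR R) -> \bar R}) :
  (m1 setT < +oo)%E ->
  (forall x, m1 `]-oo, x]%classic = m2 `]-oo, x]%classic) ->
  forall A, measurable A -> m1 A = m2 A.
Proof.
move=> fin h A mA.
apply: (@measure_unique _ R (measurableTypeR R) rays (fun n : nat => `]-oo, n%:R]%classic)) => //.
- exact: measurable_rays.
- exact: setI_closed_rays.
- by move=> n; exists n%:R.
- apply/seteqP; split => // x _; exists (Num.truncn x).+1 => //=.
  by rewrite in_itv /= ltW// truncnS_gt.
- by move=> _ [x ->].
- move=> n; apply: le_lt_trans fin.
  by apply: le_measure => //; rewrite inE.
Qed.

Lemma independent_rays d (T : measurableType d) (Q : probability T R)
  (m1 m2 : probability (measurableTypeR R) R) (f g : T -> measurableTypeR R) :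
  measurable_fun setT f -> measurable_fun setT g ->
  (forall x y, Q ((f @^-1` `]-oo, x]) `&` (g @^-1` `]-oo, y])) =
     (m1 `]-oo, x]%classic * m2 `]-oo, y]%classic)%E) ->
  forall A B, measurable A -> measurable B ->
    Q ((f @^-1` A) `&` (g @^-1` B)) = (m1 A * m2 B)%E.
Proof.
move=> mf mg h.
have pre (k : T -> measurableTypeR R) A : measurable_fun setT k -> measurable A ->
    measurable (k @^-1` A).
  by move=> mk mA; rewrite -[X in measurable X]setTI; exact: mk.
have fin k : fine (m1 k) >= 0 /\ fine (m2 k) >= 0.
  by split; exact/fine_ge0/measure_ge0.
have h1 y A : measurable A ->
    Q ((f @^-1` A) `&` (g @^-1` `]-oo, y])) = (m1 A * m2 `]-oo, y]%classic)%E.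
  move=> mA.
  have mgy : measurable (g @^-1` `]-oo, y]) by exact: pre.
  pose r := NngNum (fin `]-oo, y]%classic).2.
  have rE : r%:num%:E = m2 `]-oo, y]%classic.
    by rewrite /r /= fineK// fin_num_measure.
  rewrite muleC -rE.
  apply: (@rays_unique (pushforward (mrestr Q mgy) f) (mscale r m1)) => //.
  - rewrite /= /pushforward /mrestr preimage_setT setTI.
    by rewrite (le_lt_trans (probability_le1 _ mgy))// ltry.
  - by move=> x; rewrite /= /pushforward /mrestr /mscale h rE muleC.
move=> A B mA mB.
have mfA : measurable (f @^-1` A) by exact: pre.
pose r := NngNum (fin A).1.
have rE : r%:num%:E = m1 A by rewrite /r /= fineK// fin_num_measure.
rewrite -rE setIC.
apply: (@rays_unique (pushforward (mrestr Q mfA) g) (mscale r m2)) => //.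
- rewrite /= /pushforward /mrestr preimage_setT setTI.
  by rewrite (le_lt_trans (probability_le1 _ mfA))// ltry.
- by move=> x; rewrite /= /pushforward /mrestr /mscale setIC h1// rE.
Qed.

End rays.

Lemma finite_level_prob d (T : measurableType d) (R : realType)
  (Q : probability T R) (f : T -> nat) (B : set T) (c : R) k :
  measurable_fun setT f -> measurable B ->
  (forall i, (i < k)%N -> Q ([set x | f x = i] `&` B) = c%:E) ->
  Q ([set x | (f x < k)%N] `&` B) = (k%:R * c)%:E.
Proof.
move=> mf mB.
have mset (D : set nat) : measurable (f @^-1` D).
  by rewrite -[X in measurable X]setTI; exact: mf.
elim: k => [|k IH] h.
  rewrite mul0r (_ : _ `&` _ = set0) ?measure0//.
  by rewrite -subset0 => x [].
rewrite (_ : _ `&` _ = ([set x | (f x < k)%N] `&` B) `|`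
   ([set x | f x = k] `&` B)); last first.
  apply/seteqP; split => x /=.
    by rewrite ltnS leq_eqVlt => -[/predU1P[|] ? ?]; [right|left].
  by move=> [[fk ?]|[-> ?]]; split => //; rewrite ltnS ltnW.
rewrite measureU; last 1 first.
- rewrite -subset0 => x /= [[fk _] [fE _]].
  by rewrite fE ltnn in fk.
- rewrite -natr1 mulrDl mul1r EFinD; congr (_ + _)%E; last exact: h.
  by apply: IH => i ik; rewrite h// ltnS ltnW.
- by apply: measurableI => //; exact: (mset [set i | (i < k)%N]).
- by apply: measurableI => //; exact: (mset [set i | i = k]).
Qed.

Lemma even_bits_step n q :
  (2 * even_bits n (q %/ 4) <= even_bits n.+1 q <= 2 * even_bits n (q %/ 4) + 1)%N.
Proof. by rewrite /=; lia. Qed.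

Lemma odd_bits_step n q :
  (2 * odd_bits n (q %/ 4) <= odd_bits n.+1 q <= 2 * odd_bits n (q %/ 4) + 1)%N.
Proof. by rewrite /=; lia. Qed.

Section split_law.
Context {R : realType}.
Local Notation P := (uniform_prob (@ltr01 R)).

Definition split_fst : R -> R := digit_coordinate even_bits.
Definition split_snd : R -> R := digit_coordinate odd_bits.

Lemma measurable_split_fst : measurable_fun setT split_fst.
Proof. exact: measurable_digit_coordinate even_bits_step. Qed.

Lemma measurable_split_snd : measurable_fun setT split_snd.
Proof. exact: measurable_digit_coordinate odd_bits_step. Qed.

Let ev n (x : R) := even_bits n (quad_digits n x).
Let od n (x : R) := odd_bits n (quad_digits n x).

Let mev n : measurable_fun setT (ev n).
Proof. exact: measurable_digit_bits. Qed.
Let mod_ n : measurable_fun setT (od n).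
Proof. exact: measurable_digit_bits. Qed.

Let pre_nat (f : R -> nat) (D : set nat) : measurable_fun setT f ->
  measurable (f @^-1` D).
Proof. by move=> mf; rewrite -[X in measurable X]setTI; exact: mf. Qed.

Let P_ge1 : P `[1, +oo[%classic = 0%E.
Proof.
rewrite uniform01E// (_ : _ `&` _ = [set 1]) ?lebesgue_measure_set1//.
apply/seteqP; split => x; rewrite /= !in_itv /=.
  by rewrite andbT => -[x1 /andP[_ x2]]; apply/eqP; rewrite eq_le x2.
by move=> ->; rewrite !lexx ler01.
Qed.

Let P_digits n i j : (i < 2 ^ n)%N -> (j < 2 ^ n)%N ->
  P ([set x | ev n x = i] `&` [set x | od n x = j]) = (4 ^- n)%:E.
Proof.
move=> i2 j2; pose q := interleave n i j.
have mS : measurable ([set x | ev n x = i] `&` [set x | od n x = j]).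
  apply: measurableI; first exact: (pre_nat [set k | k = i]).
  exact: (pre_nat [set k | k = j]).
have mq : measurable [set x : R | quad_digits n x = q].
  by apply: (pre_nat [set k | k = q]); exact: measurable_quad_digits.
rewrite -(quad_digits_prob (interleave_lt n i j)) -/q.
have qS : [set x : R | quad_digits n x = q] `<=`
    [set x | ev n x = i] `&` [set x | od n x = j].
  by move=> x /= xq; rewrite /ev /od xq even_bitsK// odd_bitsK.
apply/eqP; rewrite eq_le; apply/andP; split; last first.
  by apply: le_measure => //; rewrite inE.
rewrite -[leRHS](measureU0 _ _ P_ge1)//; apply: le_measure; rewrite ?inE//.
  exact: measurableU.
move=> x /= [xi xj]; have [x1|x1] := leP 1 x; first by right; rewrite /= in_itv /= x1.
left; rewrite /q -xi -xj interleaveK//.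
by rewrite ltnNge; apply/negP => /quad_digits_ge; rewrite leNgt x1.
Qed.

Let P_box n k l : (k <= 2 ^ n)%N -> (l <= 2 ^ n)%N ->
  P ([set x | (ev n x < k)%N] `&` [set x | (od n x < l)%N]) =
  (k%:R / 2 ^+ n * (l%:R / 2 ^+ n))%:E.
Proof.
move=> k2 l2.
have -> : k%:R / 2 ^+ n * (l%:R / 2 ^+ n) = k%:R * (l%:R * (4 ^- n)) :> R.
  have -> : 4 ^+ n = 2 ^+ n * 2 ^+ n :> R by rewrite -exprMn; congr (_ ^+ n); ring.
  by rewrite invfM; ring.
apply: finite_level_prob; first exact: mev.
  by apply: (pre_nat [set i | (i < l)%N]); exact: mod_.
move=> i ik; rewrite setIC; apply: finite_level_prob; first exact: mod_.
  by apply: (pre_nat [set i' | i' = i]); exact: mev.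
move=> j jl; rewrite setIC; apply: P_digits.
  exact: leq_trans ik k2.
exact: leq_trans jl l2.
Qed.

Let split_unit a b : 0 <= a <= 1 -> 0 <= b <= 1 ->
  P ((split_fst @^-1` `]-oo, a]) `&` (split_snd @^-1` `]-oo, b])) = (a * b)%:E.
Proof.
move=> /andP[a0 a1] /andP[b0 b1]; set S := _ `&` _.
have mS : measurable S.
  apply: measurableI; rewrite -[X in measurable X]setTI.
    exact: measurable_split_fst.
  exact: measurable_split_snd.
have PS : (fine (P S))%:E = P S by rewrite fineK// fin_num_measure.
rewrite -PS; congr EFin; set p := fine _ in PS *.
apply/eqP; rewrite -subr_eq0 -normr_le0; apply/ler_addgt0Pr => e e0.
rewrite add0r.
have e30 : 0 < e / 3 by rewrite divr_gt0.
have [n ne] : exists n, 2 ^- n < e / 3 :> R.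
  have [m] := ltr_add_invr e30; rewrite add0r => me.
  exists m; apply: le_lt_trans me.
  rewrite lef_pV2 ?posrE ?exprn_gt0// ?ltr0n//.
  by rewrite -natrX ler_nat ltn_expl.
have N0 : 0 < 2 ^+ n :> R by rewrite exprn_gt0.
set h : R := 2 ^- n in ne.
have h0 : 0 < h by rewrite invr_gt0.
have h1 : h <= 1 by rewrite invf_le1// exprn_ege1// ler1n.
have Nn : (2 ^ n)%N%:R = 2 ^+ n :> R by rewrite natrX.
pose tr (c : R) := Num.truncn (2 ^+ n * c).
have trP c : 0 <= c <= 1 -> [/\ (tr c <= 2 ^ n)%N, (tr c)%:R * h <= c
    & c < (tr c)%:R * h + h].
  move=> /andP[c0 c1].
  have Nc0 : 0 <= 2 ^+ n * c by rewrite mulr_ge0// ltW.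
  have /andP[t1 t2] := truncn_itv Nc0.
  have cE : c = 2 ^+ n * c * h by rewrite /h mulrAC divff ?mul1r// gt_eqF.
  split.
  - by rewrite -(ler_nat R) Nn (le_trans t1)// ler_piMr// ltW.
  - by rewrite [leRHS]cE ler_pM2r.
  - by rewrite [ltLHS]cE -{3}[h]mul1r -mulrDl ltr_pM2r// natr1.
have [|ta2 ta ta'] := trP a; first by rewrite a0.
have [|tb2 tb tb'] := trP b; first by rewrite b0.
set x := (tr a)%:R * h in ta ta'; set y := (tr b)%:R * h in tb tb'.
have x0 : 0 <= x by rewrite mulr_ge0// ltW.
have y0 : 0 <= y by rewrite mulr_ge0// ltW.
have lower : x * y <= p.
  rewrite -lee_fin PS -(P_box ta2 tb2).
  apply: le_measure; rewrite ?inE//.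
    apply: measurableI; first by apply: (pre_nat [set i | (i < tr a)%N]); exact: mev.
    by apply: (pre_nat [set i | (i < tr b)%N]); exact: mod_.
  move=> z /= [za zb]; split; rewrite /= in_itv /=.
    apply: le_trans (digit_coordinate_le even_bits_step n z) _.
    apply: le_trans ta; rewrite /digit_approx -[X in _ + X]mul1r -mulrDl.
    by rewrite ler_pM2r// natr1 ler_nat.
  apply: le_trans (digit_coordinate_le odd_bits_step n z) _.
  apply: le_trans tb; rewrite /digit_approx -[X in _ + X]mul1r -mulrDl.
  by rewrite ler_pM2r// natr1 ler_nat.
have upper : p <= (x + h) * (y + h).
  pose k := minn (tr a).+1 (2 ^ n); pose l := minn (tr b).+1 (2 ^ n).
  have kE : k%:R * h <= x + h.
    by rewrite -{2}[h]mul1r -mulrDl ler_pM2r// natr1 ler_nat geq_minl.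
  have lE : l%:R * h <= y + h.
    by rewrite -{2}[h]mul1r -mulrDl ler_pM2r// natr1 ler_nat geq_minl.
  apply: (@le_trans _ _ (k%:R * h * (l%:R * h))); last first.
    by apply: ler_pM => //; rewrite mulr_ge0// ltW.
  rewrite -lee_fin PS -(P_box (geq_minr _ _) (geq_minr _ _)).
  apply: le_measure; rewrite ?inE//.
    apply: measurableI; first by apply: (pre_nat [set i | (i < k)%N]); exact: mev.
    by apply: (pre_nat [set i | (i < l)%N]); exact: mod_.
  move=> z; rewrite /S /= !in_itv /= => -[za zb]; split; rewrite /= leq_min.
    rewrite even_bits_lt andbT ltnS truncn_ge_nat ?mulr_ge0 ?(ltW N0)//.
    rewrite mulrC -ler_pdivrMr//.
    exact: le_trans (digit_coordinate_ge even_bits_step n z) za.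
  rewrite odd_bits_lt andbT ltnS truncn_ge_nat ?mulr_ge0 ?(ltW N0)//.
  rewrite mulrC -ler_pdivrMr//.
  exact: le_trans (digit_coordinate_ge odd_bits_step n z) zb.
have xa1 : x <= 1 by rewrite (le_trans ta).
have yb1 : y <= 1 by rewrite (le_trans tb).
rewrite ler_norml; apply/andP; split; nra.
Qed.

Let split_fst_itv x : 0 <= split_fst x <= 1.
Proof. exact: (digit_coordinate_itv even_bits_lt even_bits_step). Qed.
Let split_snd_itv x : 0 <= split_snd x <= 1.
Proof. exact: (digit_coordinate_itv odd_bits_lt odd_bits_step). Qed.

Let clip (a : R) := Num.max 0 (Num.min 1 a).

Let clip_itv a : 0 <= clip a <= 1.
Proof. by rewrite /clip le_max lexx ge_max ler01 ge_min lexx. Qed.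

Let P_ray a : P `]-oo, a]%classic = (clip a)%:E.
Proof.
rewrite uniform01E// /clip.
have [a0|a0] := ltP a 0.
  rewrite (_ : _ `&` _ = set0) ?measure0; last first.
    rewrite -subset0 => x /=; rewrite !in_itv /= => -[xa /andP[x0 _]].
    by move: (le_lt_trans xa a0); rewrite ltNge x0.
  by rewrite (min_idPr _) ?(max_idPl _)// ltW// (lt_le_trans a0).
have [a1|a1] := leP 1 a.
  rewrite (_ : _ `&` _ = `[0, 1]%classic).
    by rewrite lebesgue_measure_itv/= lte_fin ltr01 oppr0 adde0 (max_idPr _).
  apply/seteqP; split => x /=; rewrite !in_itv /=; first by case.
  by move=> /andP[x0 x1]; rewrite x0 x1 (le_trans x1).
rewrite (_ : _ `&` _ = `[0, a]%classic).
  rewrite lebesgue_measure_itv/= lte_fin (max_idPr _)//.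
  case: ltP => [_|a0']; first by rewrite oppr0 adde0.
  by have -> : a = 0 by apply/eqP; rewrite eq_le a0'.
apply/seteqP; split => x /=; rewrite !in_itv /=; first by move=> [-> /andP[->]].
by move=> /andP[x0 xa]; rewrite x0 xa (le_trans xa)// ltW.
Qed.

Let split_rays a b :
  P ((split_fst @^-1` `]-oo, a]) `&` (split_snd @^-1` `]-oo, b])) =
  (P `]-oo, a]%classic * P `]-oo, b]%classic)%E.
Proof.
have [a0|a0] := ltP a 0.
  rewrite (P_ray a) (_ : clip a = 0); last first.
    by rewrite /clip (min_idPr _) ?(max_idPl _)// ltW// (lt_le_trans a0).
  rewrite mul0e (_ : _ `&` _ = set0) ?measure0//.
  rewrite -subset0 => x [/=]; rewrite !in_itv /= => xa _.
  have /andP[x0 _] := split_fst_itv x.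
  by move: (le_lt_trans xa a0); rewrite ltNge x0.
have [b0|b0] := ltP b 0.
  rewrite (P_ray b) (_ : clip b = 0); last first.
    by rewrite /clip (min_idPr _) ?(max_idPl _)// ltW// (lt_le_trans b0).
  rewrite mule0 (_ : _ `&` _ = set0) ?measure0//.
  rewrite -subset0 => x [/=]; rewrite !in_itv /= => _ xb.
  have /andP[x0 _] := split_snd_itv x.
  by move: (le_lt_trans xb b0); rewrite ltNge x0.
rewrite !P_ray -EFinM -split_unit//.
have clipE (c t : R) : 0 <= c -> t <= 1 -> (t <= clip c) = (t <= c).
  by move=> c0 t1; rewrite /clip (max_idPr _) ?le_min ?ler01 ?c0// t1.
congr (P _); apply/seteqP; split => x /=; rewrite !in_itv /= !clipE//;
  by [case/andP: (split_fst_itv x)|case/andP: (split_snd_itv x)].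
Qed.

Lemma split_uniform (A B : set R) : measurable A -> measurable B ->
  P ((split_fst @^-1` A) `&` (split_snd @^-1` B)) = (P A * P B)%E.
Proof.
exact: (@independent_rays _ _ _ P P P _ _
  measurable_split_fst measurable_split_snd split_rays).
Qed.

Definition iid_uniform n (x : R) : R := split_fst (iter n split_snd x).

Lemma measurable_iid_uniform n : measurable_fun setT (iid_uniform n).
Proof.
elim: n => [|n IH]; first exact: measurable_split_fst.
rewrite (_ : iid_uniform _ = iid_uniform n \o split_snd).
  by apply: measurableT_comp => //; exact: measurable_split_snd.
by apply/funext => x; rewrite /iid_uniform iterSr.
Qed.

Lemma iid_uniform_itv n x : 0 <= iid_uniform n x <= 1.
Proof. exact: split_fst_itv. Qed.

Lemma iid_uniformP n (A : nat -> set R) : (forall i, measurable (A i)) ->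
  P [set x | forall i, (i < n)%N -> A i (iid_uniform i x)] =
  (\prod_(i < n) fine (P (A i)))%:E.
Proof.
elim: n A => [|n IH] A mA.
  by rewrite big_ord0 (_ : [set _ | _] = setT) ?probability_setT//; apply/seteqP.
pose S := [set x | forall i, (i < n)%N -> A i.+1 (iid_uniform i x)].
have mS : measurable S.
  rewrite (_ : S = \bigcap_i (if (i < n)%N then iid_uniform i @^-1` A i.+1 else setT)).
    apply: bigcapT_measurable => i; case: ifP => // _.
    by rewrite -[X in measurable X]setTI; exact: measurable_iid_uniform.
  apply/seteqP; split => x h i; first by move=> _; case: ifP => // /h.
  by move=> ni; have := h i I; rewrite ni.
rewrite (_ : [set _ | _] = (split_fst @^-1` A 0%N) `&` (split_snd @^-1` S)).
  rewrite split_uniform// big_ord_recl EFinM fineK; last first.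
    exact: (fin_num_measure P _ (mA 0%N)).
  by congr (_ * _)%E; exact: (IH (fun i => A i.+1)).
apply/seteqP; split => x /=.
  move=> h; split; first exact: (h 0%N).
  by move=> i ni; have := h i.+1 ni; rewrite /iid_uniform iterSr.
move=> [h0 h] [|i] ni //.
by have := h i ni; rewrite /iid_uniform iterSr.
Qed.

End split_law.

Definition unit_interval (R : realType) := {x : R | 0 <= x <= 1}.

Section unit_interval_instances.
Context {R : realType}.
HB.instance Definition _ := Choice.on (unit_interval R).

Let zero_in_unit : 0 <= (0 : R) <= 1.
Proof. by rewrite lexx ler01. Qed.

HB.instance Definition _ := isPointed.Build (unit_interval R)
  (exist _ 0 zero_in_unit).

End unit_interval_instances.

Lemma countable_retraction (T : Type) (t0 : T) (e : T -> nat) :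
  {in [set: T] &, injective e} -> exists v : nat -> T, cancel e v.
Proof.
move=> einj; exists (fun n =>
  if pselect (exists g, e g = n) is left h then sval (cid h) else t0).
move=> g; case: pselect => [h|[]]; last by exists g.
by apply: einj; rewrite ?inE//; exact: svalP (cid h).
Qed.

Section bernoulli_space.
Context (R : realType) (Gamma : groupType).
Local Notation I := (unit_interval R).

Definition coordinate_events : set (set (Gamma -> I)) :=
  [set E | exists g (B : set R), measurable B /\ E = [set f | B (sval (f g))]].

Definition bernoulli_type : measurableType _ :=
  g_sigma_algebraType coordinate_events.

Definition cylinder (s : seq Gamma) (B : Gamma -> set R) : set bernoulli_type :=
  [set f | forall g, g \in s -> B g (sval (f g))].

Definition is_product_lebesgue (Q : set bernoulli_type -> \bar R) : Prop :=
  forall (s : seq Gamma) (B : Gamma -> set R), uniq s ->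
    (forall g, measurable (B g)) ->
    Q (cylinder s B) =
      (\prod_(g <- s) fine (lebesgue_measure (B g `&` `[0, 1])))%:E.

Lemma measurable_coordinate g :
  measurable_fun setT (fun f : bernoulli_type => sval (f g)).
Proof.
move=> _ B mB; rewrite setTI; apply: sub_sigma_algebra.
by exists g, B.
Qed.

Lemma measurable_to_bernoulli d (T : measurableType d)
  (F : T -> bernoulli_type) :
  (forall g, measurable_fun setT (fun x => sval (F x g))) ->
  measurable_fun setT F.
Proof.
move=> mF; apply: (@measurability _ _ T bernoulli_type setT F coordinate_events) => //.
move=> _ [_ [g [B [mB ->]]] <-]; exact: mF.
Qed.

Lemma measurable_cylinder s B : (forall g, measurable (B g)) ->
  measurable (cylinder s B).
Proof.
move=> mB; elim: s => [|g s IH].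
  rewrite (_ : cylinder _ _ = setT); first exact: measurableT.
  by apply/seteqP.
rewrite (_ : cylinder _ _ =
    (fun f : bernoulli_type => sval (f g)) @^-1` B g `&` cylinder s B).
  apply: measurableI => //; rewrite -[X in measurable X]setTI.
  exact: measurable_coordinate.
apply/seteqP; split => f /=.
  move=> h; split; first by apply: h; rewrite inE eqxx.
  by move=> h' hs; apply: h; rewrite inE hs orbT.
by move=> [h1 h2] h; rewrite inE => /predU1P[->//|]; exact: h2.
Qed.

Definition cylinders : set (set bernoulli_type) :=
  [set C | exists s B, [/\ uniq s, (forall g, measurable (B g)) & C = cylinder s B]].

Lemma measurable_cylinders : @measurable _ bernoulli_type = <<s cylinders >>.
Proof.
apply/seteqP; split; apply: smallest_sub.
- exact: smallest_sigma_algebra.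
- move=> _ [g [B [mB ->]]]; apply: sub_sigma_algebra.
  exists [:: g], (fun=> B); split => //.
  apply/seteqP; split => f /= h; first by move=> h'; rewrite inE => /eqP->.
  by apply: h; rewrite inE.
- exact: sigma_algebra_measurable.
- by move=> _ [s [B [_ mB ->]]]; exact: measurable_cylinder.
Qed.

Lemma setI_closed_cylinders : setI_closed cylinders.
Proof.
move=> _ _ [s [B [_ mB ->]]] [t [C [_ mC ->]]].
exists (undup (s ++ t)), (fun g => (if g \in s then B g else setT) `&`
                                   (if g \in t then C g else setT)).
split; first exact: undup_uniq.
  by move=> g; apply: measurableI; case: ifP.
apply/seteqP; split => f /=.
  by move=> [h1 h2] g _; split; case: ifP => //; [exact: h1|exact: h2].
move=> h; split => g gs; have := h g; rewrite mem_undup mem_cat gs ?orbT.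
  by move=> /(_ isT)[].
by move=> /(_ isT)[].
Qed.

Lemma is_product_lebesgue_unique (Q Q' : probability bernoulli_type R) :
  is_product_lebesgue Q -> is_product_lebesgue Q' ->
  forall A, measurable A -> Q A = Q' A.
Proof.
move=> hQ hQ' A mA.
have cT : cylinders setT.
  exists [::], (fun=> setT); split => //.
  by apply/seteqP.
apply: (measure_unique cylinders (fun _ : nat => setT)) => //.
- exact: measurable_cylinders.
- exact: setI_closed_cylinders.
- by apply/seteqP; split => // x _; exists 0%N.
- by move=> _ [s [B [us mB ->]]]; rewrite /= hQ// hQ'.
- by move=> _; rewrite /= probability_setT ltry.
Qed.

Lemma product_lebesgue_exists : countable [set: Gamma] ->
  exists Q : probability bernoulli_type R, is_product_lebesgue Q.
Proof.
move=> /countable_injP[e einj].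
pose F (x : measurableTypeR R) : bernoulli_type :=
  fun g => exist _ (iid_uniform (e g) x) (iid_uniform_itv (e g) x).
have mF : measurable_fun [set: measurableTypeR R] F.
  by apply: measurable_to_bernoulli => g; exact: measurable_iid_uniform.
pose P : probability (measurableTypeR R) R := uniform_prob (@ltr01 R).
pose X : {mfun measurableTypeR R >-> bernoulli_type} :=
  mfun_Sub (mem_set mF).
exists (distribution P X) => s B us mB.
have mBI g : fine (P (B g)) = fine (lebesgue_measure (B g `&` `[0, 1])).
  by congr fine; exact: uniform01E.
under eq_bigr do rewrite -mBI.
have [v vK] := countable_retraction 1%g einj.
pose A n := if n \in [seq e g | g <- s] then B (v n) else setT.
pose N := (\max_(g <- s) e g).+1.
have eN g : g \in s -> (e g < N)%N.
  by move=> gs; rewrite ltnS; apply: leq_bigmax_seq.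
have mA n : measurable (A n) by rewrite /A; case: ifP.
have FE : F @^-1` cylinder s B =
    [set x | forall i, (i < N)%N -> A i (iid_uniform i x)].
  apply/seteqP; split => x /= h.
    move=> i _; rewrite /A; case: ifP => // /mapP[g gs ->].
    by rewrite vK; exact: (h g gs).
  move=> g gs; have := h _ (eN g gs).
  by rewrite /A map_f// vK.
transitivity (P (F @^-1` cylinder s B)); first by [].
rewrite FE.
have uE : uniq [seq e g | g <- s].
  by rewrite map_inj_uniq// => g h; apply: einj; rewrite inE.
transitivity ((\prod_(i < N) fine (P (A i)))%:E).
  exact: (@iid_uniformP R N A mA).
congr EFin.
transitivity (\prod_(i <- [seq e g | g <- s]) fine (P (A i))).
  rewrite -(big_mkord xpredT (fun i => fine (P (A i)))).
  rewrite (bigID (mem [seq e g | g <- s])) /= [X in _ * X]big1 ?mulr1.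
    rewrite -big_filter; apply: perm_big; apply: uniq_perm => //.
      by rewrite filter_uniq// iota_uniq.
    move=> i; rewrite mem_filter mem_index_iota leq0n /= andb_idr//.
    by move=> /mapP[g gs ->]; exact: eN.
  by move=> i /negbTE ins; rewrite /A ins probability_setT.
rewrite big_map; apply: eq_big_seq => g gs.
by rewrite /A map_f// vK.
Qed.

End bernoulli_space.

Section bernoulli_standard.
Context (R : realType) (Gamma : groupType).
Hypothesis Gamma_countable : countable [set: Gamma].
Local Notation X := (bernoulli_type R Gamma).

Lemma unit_interval_dist (x y : unit_interval R) : `|sval x - sval y| <= 1.
Proof.
case: x y => [x /= /andP[x0 x1]] [y /= /andP[y0 y1]].
by rewrite ler_norml; apply/andP; split; lra.
Qed.

Lemma standard_borel_bernoulli : standard_borel (R := R) X.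
Proof.
have /countable_injP[e einj] := Gamma_countable.
have [v vK] := countable_retraction 1%g einj.
pose w g : R := 2 ^- e g.
have w0 g : 0 < w g by rewrite invr_gt0 exprn_gt0.
have w1 g : w g <= 1 by rewrite invf_le1 ?exprn_gt0// exprn_ege1// ler1n.
pose gap (f h : X) g := w g * `|sval (f g) - sval (h g)|.
have gap1 f h g : gap f h g <= w g.
  by rewrite ler_piMr ?(ltW (w0 g))// unit_interval_dist.
pose D (f h : X) : R := sup (range (gap f h)).
have supD f h : has_sup (range (gap f h)).
  split; first by exists (gap f h 1%g), 1%g.
  by exists 1 => _ [g _ <-]; rewrite (le_trans (gap1 f h g)).
have DP f h c : D f h <= c <-> forall g, gap f h g <= c.
  split => [Dc g|hc].
    by apply: le_trans Dc; apply: ub_le_sup; [case: (supD f h)|exists g].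
  by apply: ge_sup; [case: (supD f h)|move=> _ [g _ <-]].
have Dge f h g : gap f h g <= D f h by have /DP := lexx (D f h); apply.
have gap0 f h g : 0 <= gap f h g by rewrite mulr_ge0// ltW.
have Dm : is_metric D.
  split => [f h|f h|f h k].
  - split => [D0|->]; last first.
      apply/eqP; rewrite eq_le (le_trans (gap0 h h 1%g) (Dge _ _ _)) andbT.
      by apply/DP => g; rewrite /gap subrr normr0 mulr0.
    apply/funext => g; apply: val_inj => /=; apply/eqP.
    by rewrite -subr_eq0 -normr_le0 -(pmulr_rle0 _ (w0 g)); have := Dge f h g; rewrite D0.
  - congr sup; apply/seteqP; split => _ [g _ <-]; exists g => //;
      by rewrite /gap distrC.
  - apply/DP => g; apply: le_trans (lerD (Dge f h g) (Dge h k g)).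
    by rewrite /gap -mulrDr ler_pM2l// ler_distD.
have Dsep : metric_separable D.
  pose clip (x : R) := Num.max 0 (Num.min 1 x).
  have clip_itv x : 0 <= clip x <= 1.
    by rewrite /clip le_max lexx ge_max ler01 ge_min lexx.
  have clip_dist (x : R) (y : unit_interval R) :
      `|sval y - clip x| <= `|sval y - x|.
    case: y => [y /= /andP[y0 y1]]; rewrite /clip.
    have [x1|x1] := leP 1 x; have [x0|x0] := leP 0 _.
    - by rewrite !ler0_norm ?subr_le0// ?(le_trans y1)//; lra.
    - lra.
    - by [].
    - by rewrite !ger0_norm ?subr_ge0//; lra.
  pose S (s : seq rat) : X := fun g =>
    exist (fun x : R => is_true (0 <= x <= 1)) _ (clip_itv (ratr s`_(e g))).
  exists (fun n => if unpickle n is Some s then S s else S [::]) => f c c0.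
  have c20 : 0 < c / 2 by rewrite divr_gt0.
  have [N Nc] : exists N, 2 ^- N < c / 2 :> R.
    have [m] := ltr_add_invr c20; rewrite add0r => me.
    exists m; apply: le_lt_trans me.
    rewrite lef_pV2 ?posrE ?exprn_gt0// ?ltr0n//.
    by rewrite -natrX ler_nat ltn_expl.
  have /choice[q qP] : forall n, exists q : rat,
      `|sval (f (v n)) - ratr q| < c / 2.
    move=> n; set y := sval _.
    have [q] := @rat_in_itvoo R (y - c / 2) (y + c / 2) ltac:(lra).
    rewrite in_itv /= => /andP[q1 q2].
    by exists q; rewrite ltr_norml; apply/andP; split; lra.
  exists (pickle (mkseq q N)); rewrite pickleK.
  apply: (@le_lt_trans _ _ (c / 2)); last by lra.
  apply/DP => g; have [eN|Ne] := ltnP (e g) N.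
    rewrite /gap /= nth_mkseq//.
    apply: (@le_trans _ _ `|sval (f g) - clip (ratr (q (e g)))|).
      by rewrite ler_piMl.
    apply: (le_trans (clip_dist _ _)); apply: ltW.
    by have := qP (e g); rewrite vK.
  apply: le_trans (gap1 _ _ _) _; apply: le_trans (ltW Nc).
  by rewrite lef_pV2 ?posrE ?exprn_gt0// ler_weXn2l// ler1n.
have mball f c : measurable [set h | D f h <= c].
  rewrite (_ : [set _ | _] =
      \bigcap_n (fun h : X => sval (h (v n))) @^-1`
        [set y | w (v n) * `|sval (f (v n)) - y| <= c]); last first.
    apply/seteqP; split => h /=; first by move=> /DP Dc n _ /=; exact: Dc.
    by move=> hc; apply/DP => g; have := hc (e g) I; rewrite /= vK.
  apply: bigcapT_measurable => n; rewrite -[X in measurable X]setTI.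
  apply: measurable_coordinate => //; rewrite -[X in measurable X]setTI.
  rewrite [X in measurable X](_ : _ = setT `&`
      [set y : measurableTypeR R | w (v n) * `|sval (f (v n)) - y| <= c])//.
  apply: (measurable_fun_ler (f := fun y : measurableTypeR R =>
    w (v n) * `|sval (f (v n)) - y|)) => //.
  apply: measurable_funM => //; apply: measurableT_comp => //.
  exact: measurable_funB.
exists D; split => //.
- move=> u uC.
  have cC g : cvgn (fun n => sval (u n g)).
    apply/cauchy_cvgP/cauchy_exP => c c0; have [N NP] := uC _ (mulr_gt0 (w0 g) c0).
    exists (sval (u N g)); exists N => // n /= Nn; rewrite /ball /=.
    rewrite -(ltr_pM2l (w0 g)).
    exact: le_lt_trans (Dge (u N) (u n) g) (NP _ _ (leqnn N) Nn).
  pose l0 g := limn (fun n => sval (u n g)).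
  have l0P g : 0 <= l0 g <= 1.
    apply/andP; split.
      by apply: limr_ge => //; apply: nearW => n; case/andP: (svalP (u n g)).
    by apply: limr_le => //; apply: nearW => n; case/andP: (svalP (u n g)).
  pose l : X := fun g =>
    exist (fun x : R => is_true (0 <= x <= 1)) (l0 g) (l0P g).
  exists l => c c0.
  have c20 : 0 < c / 2 by rewrite divr_gt0.
  have [N NP] := uC _ c20; exists N => n Nn.
  apply: (@le_lt_trans _ _ (c / 2)); last by lra.
  apply/DP => g.
  have : (fun m => gap (u n) (u m) g) @ \oo --> gap (u n) l g.
    apply: cvgM; first exact: cvg_cst.
    apply: cvg_norm; apply: cvgB; first exact: cvg_cst.
    exact: cC.
  move=> cv; rewrite -(cvg_lim (@Rhausdorff R) cv).
  apply: limr_le; first by apply/cvg_ex; exists (gap (u n) l g).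
  near=> m; apply: (le_trans (Dge (u n) (u m) g)); apply/ltW/NP => //.
  by near: m; exact: nbhs_infty_ge.
- apply/seteqP; split; last first.
    apply: smallest_sub; first exact: sigma_algebra_measurable.
    exact: metric_open_measurable.
  apply: smallest_sub; first exact: smallest_sigma_algebra.
  move=> _ [g [B [mB ->]]].
  have {}mB : <<s RGenOInfty.G (R := R) >> B.
    have mE : @measurable _ (measurableTypeR R) = <<s RGenOInfty.G (R := R) >>.
      exact: RGenOInfty.measurableE.
    by rewrite -mE.
  apply: (preimage_generated (f := fun f : X => sval (f g)) _ mB).
  move=> _ [x ->]; apply: sub_sigma_algebra => f.
  rewrite /= in_itv /= andbT => xf.
  exists (w g * (sval (f g) - x)); first by rewrite mulr_gt0// subr_gt0.
  move=> h /= /(le_lt_trans (Dge f h g)); rewrite /gap ltr_pM2l// in_itv /= andbT.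
  by move=> /(le_lt_trans (ler_norm _)); lra.
Unshelve. all: by end_near. Qed.

End bernoulli_standard.

Section bernoulli_action.
Context (R : realType) (Gamma : groupType).
Hypothesis Gamma_countable : countable [set: Gamma].

(* By [is_product_lebesgue_unique], this is the only measure satisfying
   [is_product_lebesgue]. *)
Definition bernoulli_measure : probability (bernoulli_type R Gamma) R :=
  sval (cid (product_lebesgue_exists R Gamma_countable)).

Lemma bernoulli_measureP : is_product_lebesgue bernoulli_measure.
Proof. exact: svalP (cid (product_lebesgue_exists R Gamma_countable)). Qed.

Definition bernoulli_space : std_prob_space R :=
  StdProbSpace bernoulli_measure (standard_borel_bernoulli R Gamma_countable).

Definition shift (g : Gamma) (f : bernoulli_space) : bernoulli_space :=
  fun h => f (g^-1 * h)%g.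

Let shift_1 f : shift 1%g f = f.
Proof. by apply/funext => h; rewrite /shift invg1 mul1g. Qed.

Let shift_M g h f : shift (g * h)%g f = shift g (shift h f).
Proof. by apply/funext => k; rewrite /shift invgM mulgA. Qed.

Let shift_measurable g : measurable_fun setT (shift g).
Proof.
by apply: measurable_to_bernoulli => h; exact: measurable_coordinate.
Qed.

Let shift_preserving g (A : set bernoulli_space) : measurable A ->
  sps_prob bernoulli_space (shift g @^-1` A) = sps_prob bernoulli_space A.
Proof.
move=> mA.
pose X : {mfun bernoulli_type R Gamma >-> bernoulli_type R Gamma} :=
  mfun_Sub (mem_set (shift_measurable g)).
apply: (@is_product_lebesgue_unique _ _ (distribution bernoulli_measure X)
  bernoulli_measure) => //; last exact: bernoulli_measureP.
move=> s B us mB.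
transitivity (bernoulli_measure
  (cylinder [seq (g^-1 * h)%g | h <- s] (fun h => B (g * h)%g))).
  rewrite /distribution /pushforward; congr (bernoulli_measure _).
  apply/seteqP; split => f /= hf h.
    by move=> /mapP[k ks ->]; rewrite mulgA mulgV mul1g; exact: hf.
  by move=> hs; have := hf _ (map_f _ hs); rewrite mulgA mulgV mul1g.
rewrite bernoulli_measureP//; last first.
  by rewrite map_inj_uniq//; exact: mulgI.
rewrite big_map; congr EFin; apply: eq_bigr => h _.
by rewrite mulgA mulgV mul1g.
Qed.

Definition bernoulli_shift : pmp_action R Gamma :=
  PmpAction shift_1 shift_M shift_measurable shift_preserving.

End bernoulli_action.

(* Main.v *)
(* Let c be ergodic and weakly equivalent to iota x b, and let D be a subset of
   X with 0 < mu(D) < 1.  The invariant set D x Y is modelled in c by almost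
   invariant sets A of measure close to mu(D).  By the mean ergodic theorem some
   average of translates of A is close in L2 to the constant mu(A); this is a
   condition on finitely many numbers mu(gA /\ A), so it passes to a model B of A
   in iota x b.  As Gamma does not move the first coordinate, some section of B
   is almost invariant and has measure close to mu(D): b is not strongly ergodic.

   For the Bernoulli shift, the products of binary digits of coordinates (Walsh
   functions) form an orthonormal family, indexed by finite subsets of
   Gamma x nat and permuted by Gamma.  The squared coefficients of an almost
   invariant set of variance bounded below give an almost invariant measure on
   the nonempty finite subsets, hence an almost invariant mean on Gamma, and a
   limit along an ultrafilter shows that Gamma is amenable. *)
Require Import Defs.
From mathcomp Require Import all_boot all_order all_algebra finmap.
From mathcomp Require Import all_classical all_reals all_analysis.
From mathcomp Require Import measurable_realfun.
From mathcomp Require Import ring lra zify.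

Set Implicit Arguments.
Unset Strict Implicit.
Unset Printing Implicit Defensive.
Import Order.TTheory GRing.Theory Num.Theory.
Import numFieldNormedType.Exports.
Local Open Scope classical_set_scope.
Local Open Scope ring_scope.

(** * Means of bounded functions *)

(** Ergodicity is in general not preserved by weak equivalence, and weak containment carries over
    only finitely many measures of intersections, up to an error. Ergodicity of c therefore has to
    be traded for a finite certificate before it can reach iota x b. The certificate is stated in L2
    because a square deviation expands into correlations of translates.

    In the Bernoulli part, limits of orthogonal series are avoided: an almost invariant set is
    replaced with one whose indicator is a finite Walsh sum, and Parseval's identity becomes a
    finite computation. The coefficient at the empty index is the mean, so the squared coefficients
    at nonempty indices add up to the variance. This is why a variance bounded below leaves a mass
    that can be spread over [Gamma] and normalized. *)

Section bounded_measurable.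
Context d (T : measurableType d) (R : realType).
Implicit Types f g h : T -> R.

Definition bounded_measurable f : Prop :=
  measurable_fun setT f /\ exists M, forall x, `|f x| <= M.

Lemma bounded_measurable_cst c : bounded_measurable (fun=> c).
Proof. by split => //; exists `|c|. Qed.

Lemma bounded_measurableD f g : bounded_measurable f -> bounded_measurable g ->
  bounded_measurable (fun x => f x + g x).
Proof.
move=> [mf [M fM]] [mg [N gN]]; split; first exact: measurable_funD.
by exists (M + N) => x; rewrite (le_trans (ler_normD _ _))// lerD.
Qed.

Lemma bounded_measurableM f g : bounded_measurable f -> bounded_measurable g ->
  bounded_measurable (fun x => f x * g x).
Proof.
move=> [mf [M fM]] [mg [N gN]]; split; first exact: measurable_funM.
by exists (M * N) => x; rewrite normrM ler_pM.
Qed.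

Lemma bounded_measurableB f g : bounded_measurable f -> bounded_measurable g ->
  bounded_measurable (fun x => f x - g x).
Proof.
move=> hf hg; have := bounded_measurableD hf
  (bounded_measurableM (bounded_measurable_cst (-1)) hg).
by congr bounded_measurable; apply/funext => x; rewrite mulN1r.
Qed.

Lemma bounded_measurableX f n : bounded_measurable f ->
  bounded_measurable (fun x => f x ^+ n).
Proof.
move=> hf; elim: n => [|n IH]; first exact: bounded_measurable_cst.
have := bounded_measurableM hf IH.
by congr bounded_measurable; apply/funext => x; rewrite exprS.
Qed.

Lemma bounded_measurable_norm f : bounded_measurable f ->
  bounded_measurable (fun x => `|f x|).
Proof.
move=> [mf [M fM]]; split; last by exists M => x; rewrite normr_id.
exact: measurableT_comp.
Qed.

Lemma bounded_measurable_indic (A : set T) : measurable A ->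
  bounded_measurable (\1_A).
Proof.
move=> mA; split; first exact: measurable_indic.
by exists 1 => x; rewrite indicE; case: (_ \in _); rewrite ?normr1 ?normr0.
Qed.

Lemma bounded_measurable_sum I (s : seq I) (f : I -> T -> R) :
  (forall i, bounded_measurable (f i)) ->
  bounded_measurable (fun x => \sum_(i <- s) f i x).
Proof.
move=> hf; elim: s => [|i s IH].
  have := bounded_measurable_cst 0.
  by congr bounded_measurable; apply/funext => x; rewrite big_nil.
have := bounded_measurableD (hf i) IH.
by congr bounded_measurable; apply/funext => x; rewrite big_cons.
Qed.

Lemma bounded_measurable_prod I (s : seq I) (f : I -> T -> R) :
  (forall i, bounded_measurable (f i)) ->
  bounded_measurable (fun x => \prod_(i <- s) f i x).
Proof.
move=> hf; elim: s => [|i s IH].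
  have := bounded_measurable_cst 1.
  by congr bounded_measurable; apply/funext => x; rewrite big_nil.
have := bounded_measurableM (hf i) IH.
by congr bounded_measurable; apply/funext => x; rewrite big_cons.
Qed.

End bounded_measurable.

Ltac bounded := repeat first
  [ assumption
  | match goal with H : forall _, bounded_measurable _ |- _ => exact: H end
  | match goal with H : forall _ _, bounded_measurable _ |- _ => exact: H end
  | exact: bounded_measurable_cst | exact: bounded_measurable_indic
  | apply: bounded_measurable_sum => ? | apply: bounded_measurable_prod => ?
  | apply: bounded_measurable_norm | apply: bounded_measurableX
  | apply: bounded_measurableB | apply: bounded_measurableD
  | apply: bounded_measurableM ].

Section mean.
Context d (T : measurableType d) (R : realType) (P : probability T R).
Implicit Types f g h : T -> R.
Local Notation E f := (\int[P]_x f x).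

Lemma bounded_integrable f : bounded_measurable f ->
  P.-integrable setT (EFin \o f).
Proof.
move=> [mf [M fM]]; apply: measurable_bounded_integrable => //.
  by rewrite /= probability_setT ltry.
by exists M; split; [exact: num_real|move=> K MK x _; exact: le_trans (fM x) (ltW MK)].
Qed.

Lemma meanD f g : bounded_measurable f -> bounded_measurable g ->
  E (fun x => f x + g x) = E f + E g.
Proof. by move=> hf hg; rewrite RintegralD//; exact: bounded_integrable. Qed.

Lemma meanB f g : bounded_measurable f -> bounded_measurable g ->
  E (fun x => f x - g x) = E f - E g.
Proof. by move=> hf hg; rewrite RintegralB//; exact: bounded_integrable. Qed.

Lemma meanZ c f : bounded_measurable f -> E (fun x => c * f x) = c * E f.
Proof. by move=> hf; rewrite RintegralZl//; exact: bounded_integrable. Qed.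

Lemma mean_cst c : E (fun=> c) = c.
Proof.
by rewrite Rintegral_cst//= (_ : P setT = 1%E) ?mulr1//; exact: probability_setT.
Qed.

Lemma mean_sum I (s : seq I) (f : I -> T -> R) :
  (forall i, bounded_measurable (f i)) ->
  E (fun x => \sum_(i <- s) f i x) = \sum_(i <- s) E (f i).
Proof.
move=> hf; elim: s => [|i s IH].
  by rewrite big_nil -[RHS](mean_cst 0); apply: eq_Rintegral => x _; rewrite big_nil.
rewrite big_cons -IH -meanD//; last exact: bounded_measurable_sum.
by apply: eq_Rintegral => x _; rewrite big_cons.
Qed.

Lemma mean_ge0 f : (forall x, 0 <= f x) -> 0 <= E f.
Proof. by move=> f0; exact: Rintegral_ge0. Qed.

Lemma le_mean f g : bounded_measurable f -> bounded_measurable g ->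
  (forall x, f x <= g x) -> E f <= E g.
Proof. by move=> hf hg fg; apply: le_Rintegral => //; exact: bounded_integrable. Qed.

Lemma mean_indic (A : set T) : measurable A -> E (\1_A) = fine (P A).
Proof. by move=> mA; rewrite /Rintegral integral_indic// setIT. Qed.

Lemma mean_EFin f : bounded_measurable f -> (E f)%:E = (\int[P]_x (f x)%:E)%E.
Proof.
move=> hf; rewrite /Rintegral fineK//; apply: integrable_fin_num => //.
exact: bounded_integrable.
Qed.

Lemma mean_sqr_le f : bounded_measurable f -> E f ^+ 2 <= E (fun x => f x ^+ 2).
Proof.
move=> hf.
have : 0 <= E (fun x => (f x - E f) ^+ 2) by apply: mean_ge0 => x; exact: sqr_ge0.
have -> : E (fun x => (f x - E f) ^+ 2) =
    E (fun x => (f x ^+ 2 - (2 * E f) * f x) + E f ^+ 2).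
  by apply: eq_Rintegral => x _; ring.
by rewrite meanD ?meanB ?meanZ ?mean_cst//; try bounded; nra.
Qed.

Lemma mean_comp (phi : T -> T) f : measurable_fun setT phi ->
  (forall A, measurable A -> P (phi @^-1` A) = P A) ->
  bounded_measurable f -> E (f \o phi) = E f.
Proof.
move=> mphi pphi hf; have [mf _] := hf.
have [h hE] : exists h : {mfun T >-> T}, h = phi :> (_ -> _).
  by exists (mfun_Sub (mem_set mphi)).
rewrite /Rintegral -hE; congr fine.
rewrite -[LHS](@integral_pushforward _ _ _ _ _ h _ P setT (EFin \o f))//.
- by apply: eq_measure_integral => A mA _; have := pphi A mA; rewrite -hE => hA; exact: hA.
- exact/measurable_EFinP.
- rewrite preimage_setT; apply: (bounded_integrable (f := f \o h)).
  split; last by case: hf => _ [M fM]; exists M => x; exact: fM.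
  exact: measurableT_comp.
Qed.

Lemma bounded_measurable_comp (phi : T -> T) f : measurable_fun setT phi ->
  bounded_measurable f -> bounded_measurable (f \o phi).
Proof.
move=> mphi [mf [M fM]]; split; first exact: measurableT_comp.
by exists M => x; exact: fM.
Qed.

Lemma mean_norm_eq0 f : bounded_measurable f -> E (fun x => `|f x|) = 0 ->
  P [set x | f x != 0] = 0%E.
Proof.
move=> hf; have [mf _] := hf.
move=> h; have {h} := congr1 EFin h; rewrite mean_EFin; last exact: bounded_measurable_norm.
move=> /(ae_eq_integral_abs P measurableT (f := EFin \o f)).
have mEf : measurable_fun setT (EFin \o f) by exact/measurable_EFinP.
move=> /(_ mEf) [N [mN PN fN]].
apply/eqP; rewrite -measure_le0 -PN; apply: le_measure; rewrite ?inE//.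
  rewrite (_ : [set _ | _] = setT `&` f @^-1` (~` [set 0])); last first.
    by rewrite setTI; apply/seteqP; split => x /= /eqP.
  by apply: mf => //; exact: measurableC.
move=> x /= fx; apply: fN => /= /(_ I) [] /eqP; exact/negP.
Qed.

End mean.

(** * The mean ergodic theorem *)

Lemma half_power_lt (R : realType) (e : R) : 0 < e -> exists n, 2 ^- n < e.
Proof.
move=> e0; have [m] := ltr_add_invr e0; rewrite add0r => me.
exists m; apply: le_lt_trans me.
by rewrite lef_pV2 ?posrE ?exprn_gt0// ?ltr0n// -natrX ler_nat ltn_expl.
Qed.

Lemma le0_half_power (R : realType) (x c : R) : (forall n, x <= c * 2 ^- n) -> x <= 0.
Proof.
move=> xc; rewrite leNgt; apply/negP => x0.
have c0 : 0 < `|c| + 1 by rewrite ltr_wpDl.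
have [n] := half_power_lt (divr_gt0 x0 c0).
rewrite ltr_pdivlMr// mulrC => /lt_le_trans/(_ (xc n)).
apply/negP; rewrite -leNgt ler_pM2r ?invr_gt0 ?exprn_gt0//.
by rewrite (le_trans (ler_norm _))// lerDl.
Qed.

Lemma normr_limn_sup_le (R : realType) (u : nat -> R) (y r : R) n :
  bounded_fun (u : R^o^nat) ->
  (forall m, (n <= m)%N -> `|u m - y| <= r) -> `|limn_sup (u : R^o^nat) - y| <= r.
Proof.
move=> bu ur; rewrite limn_supE//.
have hu k : has_ubound (sdrop (u : R^o^nat) k).
  case: bu => M [_ /(_ (M + 1) ltac:(by rewrite ltrDl))] Mu.
  by exists (M + 1) => _ [j _ <-]; rewrite (le_trans (ler_norm _))// Mu.
have sups_ge k : y - r <= sups (u : R^o^nat) k.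
  have := ur _ (leq_maxl n k); rewrite ler_norml => /andP[h _].
  have : u (maxn n k) <= sups (u : R^o^nat) k.
    by apply: ub_le_sup => //; exists (maxn n k) => //=; exact: leq_maxr.
  by apply: le_trans; lra.
rewrite ler_norml; apply/andP; split.
  suff : y - r <= inf (range (sups (u : R^o^nat))) by lra.
  by apply: lb_le_inf; [exists (sups (u : R^o^nat) 0%N), 0%N|move=> _ [k _ <-]].
suff : inf (range (sups (u : R^o^nat))) <= y + r by lra.
apply: (@le_trans _ _ (sups (u : R^o^nat) n)).
  by apply: inf_lbound; [exists (y - r) => _ [k _ <-]|exists n].
apply: ge_sup; first by exists (u n), n => /=.
by move=> _ [m /= nm <-]; have := ur m nm; rewrite ler_norml => /andP[]; lra.
Qed.

(** * Limits of rapidly converging sequences *)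

Section fast_limit.
Context d (T : measurableType d) (R : realType) (P : probability T R).
Local Notation E f := (\int[P]_x f x).

(** The pointwise upper limit serves as [h]: it is measurable and has values in [0, 1] at every
    point, whether or not the sequence converges there. The distance from [v n] to [h] is at most
    the sum of the later increments, whose integral is a geometric tail. *)
Lemma fast_L1_limit (v : nat -> T -> R) :
  (forall n, measurable_fun setT (v n)) -> (forall n x, 0 <= v n x <= 1) ->
  (forall n, E (fun x => `|v n.+1 x - v n x|) <= 2 ^- n) ->
  exists h : T -> R, [/\ measurable_fun setT h, forall x, 0 <= h x <= 1
    & forall n, E (fun x => `|v n x - h x|) <= 2 * 2 ^- n].
Proof.
move=> mv v01 vE.
have bv n : bounded_measurable (v n).
  by split => //; exists 1 => x; have /andP[? ?] := v01 n x; rewrite ger0_norm.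
pose h x := limn_sup ((v ^~ x) : R^o^nat).
have bvx x : bounded_fun ((v ^~ x) : R^o^nat).
  exists 1; split; first exact: num_real.
  move=> M M1 n _; have /andP[? ?] := v01 n x.
  by rewrite /= ger0_norm// (le_trans _ (ltW M1)).
have mh : measurable_fun setT h.
  apply: measurable_fun_limn_sup => // x _.
    by exists 1 => _ [n _ <-]; have /andP[] := v01 n x.
  by exists 0 => _ [n _ <-]; have /andP[] := v01 n x.
have h01 x : 0 <= h x <= 1.
  have : `|h x - 1 / 2| <= 1 / 2.
    apply: (@normr_limn_sup_le _ (v ^~ x) _ _ 0 (bvx x)) => m _.
    by have := v01 m x; rewrite ler_norml; lra.
  by rewrite ler_norml; lra.
have bh : bounded_measurable h.
  by split => //; exists 1 => x; have /andP[? ?] := h01 x; rewrite ger0_norm.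
exists h; split => // n.
pose f k x := (`|v (n + k).+1 x - v (n + k)%N x|)%:E.
have bf k : bounded_measurable (fun x => `|v (n + k).+1 x - v (n + k)%N x|) by bounded.
have mf k : measurable_fun setT (f k) by apply/measurable_EFinP; case: (bf k).
have f0 k x : setT x -> (0%R <= f k x)%E by rewrite lee_fin.
rewrite -lee_fin mean_EFin; last by bounded.
apply: (@le_trans _ _ (\int[P]_x (\sum_(0 <= k <oo) f k x))%E).
  apply: ge0_le_integral => //.
  - by apply/measurable_EFinP; case: (bounded_measurable_norm (bounded_measurableB (bv n) bh)).
  - by apply: ge0_emeasurable_sum => // k x _ _; exact: f0.
  move=> x _.
  have S1 : (0 <= \sum_(0 <= k <oo) f k x)%E by apply: nneseries_ge0 => k _ _; exact: f0.
  (* Where the increments are not summable the bound is infinite, so convergence need not be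
     discussed. *)
  case SE : (\sum_(0 <= k <oo) f k x)%E => [r| |]; [|exact: leey|by rewrite SE in S1].
  rewrite lee_fin distrC; apply: (@normr_limn_sup_le _ _ _ _ n (bvx x)).
  move=> m nm; rewrite -(subnKC nm); move: (m - n)%N => j.
  rewrite -lee_fin -SE.
  apply: (@le_trans _ _ (\sum_(0 <= k < j) f k x)%E); last first.
    by apply: nneseries_lim_ge => k _ _; exact: f0.
  rewrite sumEFin lee_fin.
  elim: j => [|j IH]; first by rewrite addn0 subrr normr0 big_geq.
  rewrite big_nat_recr//= addnS.
  rewrite (le_trans (ler_distD (v (n + j)%N x) _ _))// addrC lerD//.
rewrite integral_nneseries//.
apply: lime_le.
  by apply: is_cvg_nneseries => k _ _; apply: integral_ge0 => x; exact: f0.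
apply: nearW => j.
under eq_bigr do rewrite -mean_EFin//.
rewrite sumEFin lee_fin.
(* Subtracting the remaining tail makes the induction on [j] go through. *)
apply: (@le_trans _ _ (2 * 2 ^- n - 2 * 2 ^- (n + j))); last first.
  by rewrite lerBlDr lerDl mulr_ge0// invr_ge0 exprn_ge0.
elim: j => [|j IH]; first by rewrite big_geq// addn0 subrr.
rewrite big_nat_recr//=.
have := vE (n + j)%N => h1; rewrite addnS exprS invfM.
move: IH h1; move: (\sum_(_ <= _ < _) _) (\int[P]_x _) (2 ^- (n + j)) => a b e.
by lra.
Qed.

End fast_limit.

Lemma indic_bool (T : Type) (R : nzRingType) (p : pred T) x :
  \1_[set y | p y] x = (p x)%:R :> R.
Proof. by rewrite indicE; congr ((nat_of_bool _)%:R); apply/idP/idP; rewrite inE. Qed.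

(** * Translates and invariant functions *)

Section action_facts.
Context (R : realType) (Gamma : groupType) (c : pmp_action R Gamma).
Local Notation P := (sps_prob c).
Local Notation E f := (\int[P]_x f x).
Implicit Types (f : c -> R) (g h : Gamma) (s : seq Gamma).

Lemma actK g : cancel (act c g) (act c g^-1%g).
Proof. by move=> x; rewrite -act_M mulVg act_1. Qed.

Lemma actVK g : cancel (act c g^-1%g) (act c g).
Proof. by move=> x; rewrite -act_M mulgV act_1. Qed.

Lemma act_imageE g (A : set c) : act c g @` A = act c g^-1%g @^-1` A.
Proof.
apply/seteqP; split => [_ [x Ax <-]|x /= Ax]; first by rewrite /= actK.
by exists (act c g^-1%g x) => //; rewrite actVK.
Qed.

Lemma measurable_act_preimage g (A : set c) : measurable A ->
  measurable (act c g @^-1` A).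
Proof. by move=> mA; rewrite -[X in measurable X]setTI; exact: act_measurable. Qed.

Lemma measurable_act_image g (A : set c) : measurable A ->
  measurable (act c g @` A).
Proof. by rewrite act_imageE; exact: measurable_act_preimage. Qed.

Lemma bounded_measurable_act g f : bounded_measurable f ->
  bounded_measurable (fun x => f (act c g x)).
Proof. by apply: bounded_measurable_comp; exact: act_measurable. Qed.

Lemma mean_act g f : bounded_measurable f -> E (fun x => f (act c g x)) = E f.
Proof.
by apply: mean_comp; [exact: act_measurable|move=> A; exact: act_preserving].
Qed.

(** Every upper level set is null or conull. By Markov's inequality no level above the mean is
    conull, so f <= E f almost everywhere; as f - E f has mean 0, equality holds almost
    everywhere. *)
Lemma ergodic_invariant_constant f : countable [set: Gamma] -> ergodic c ->
  bounded_measurable f -> (forall x, 0 <= f x) ->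
  (forall g, E (fun x => `|f (act c g x) - f x|) = 0) ->
  E (fun x => `|f x - E f|) = 0.
Proof.
move=> Gcount erg bf f0 finv; have [mf _] := bf.
have /countable_injP[e einj] := Gcount.
have [v vK] := countable_retraction 1%g einj.
have bfg g := bounded_measurable_act g bf.
have mge t : measurable [set x | t <= f x].
  rewrite (_ : [set _ | _] = setT `&` f @^-1` `[t, +oo[); first exact: mf.
  by rewrite setTI; apply/seteqP; split => x /=; rewrite in_itv /= andbT.
have dich t : P [set x | t <= f x] = 0%E \/ P [set x | t <= f x] = 1%E.
  (* [ergodic] speaks of strictly invariant sets only. Imposing the inequality along the whole orbit
     makes the level set strictly invariant and, [Gamma] being countable, removes only a null
     set. *)
  pose A := [set x | forall g, t <= f (act c g x)].
  have mA : measurable A.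
    rewrite (_ : A = \bigcap_n (act c (v n) @^-1` [set x | t <= f x])).
      by apply: bigcapT_measurable => n; exact: measurable_act_preimage.
    apply/seteqP; split => x /= h => [n _|g]; first exact: h.
    by have := h (e g) I; rewrite /= vK.
  have [|A0|A1] := erg A mA.
  - move=> g; rewrite act_imageE; apply/seteqP; split => x /= h k.
      by have := h (k * g)%g; rewrite act_M actVK.
    by rewrite -act_M; exact: h.
  - left; pose N g := [set x | f (act c g x) - f x != 0].
    have nN : P.-negligible (\bigcup_n N (v n)).
      apply: negligible_bigcup => n; apply/negligibleP.
        rewrite (_ : N _ = setT `&` (fun x => f (act c (v n) x) - f x) @^-1` (~` [set 0])).
          have [mfg _] : bounded_measurable (fun x => f (act c (v n) x) - f x) by bounded.
          by apply: mfg => //; exact: measurableC.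
        by rewrite setTI; apply/seteqP; split => x /= /eqP.
      by apply: mean_norm_eq0 => //; bounded.
    apply: measure_negligible => //.
    apply: negligibleS (negligibleU ((negligibleP P mA).2 A0) nN) => x /= tx.
    have [Ax|nAx] := pselect (A x); [by left|right].
    move: nAx => /existsNP[g /negP]; rewrite -ltNge => gx.
    by exists (e g) => //; rewrite vK /N /= lt_eqF// subr_lt0 (lt_le_trans gx).
  - right; apply/eqP; rewrite eq_le probability_le1//= -A1.
    apply: le_measure; rewrite ?inE// => x /(_ 1%g).
    by rewrite act_1.
have bge (t : R) : bounded_measurable (\1_[set x | t <= f x] : c -> R)
  by exact: bounded_measurable_indic.
have ge_mean (t : R) : 0 <= t -> P [set x | t <= f x] = 1%E -> t <= E f.
  move=> t0 P1; apply: (@le_trans _ _ (E (fun x => t * \1_[set x | t <= f x] x))).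
    by rewrite meanZ// mean_indic// [P _]P1 mulr1.
  apply: le_mean => //; first by bounded.
  by move=> x; rewrite indic_bool /=; case: (leP t (f x)) => tx; rewrite /= ?mulr1 ?mulr0 ?f0.
set a := E f in ge_mean *.
have a0 : 0 <= a by exact: mean_ge0.
have [_ [M fM]] := bf.
(* The integrand is twice the positive part of f - a, hence at most 2r off a null level set. Its
   mean is that of |f - a|, because f - a has mean 0. *)
have small (r : R) : 0 < r -> E (fun x => `|f x - a| + (f x - a)) <= 2 * r.
  move=> r0.
  have Pr : P [set x | a + r <= f x] = 0%E.
    have [//|P1] := dich (a + r).
    have := ge_mean _ (addr_ge0 a0 (ltW r0)) P1.
    by rewrite gerDl leNgt r0.
  apply: (@le_trans _ _ (E (fun x => 2 * r + 2 * M * \1_[set x | a + r <= f x] x))).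
    apply: le_mean => //; try bounded.
    move=> x; rewrite indic_bool; have := fM x.
    rewrite ler_norml => /andP[_ fxM]; have := f0 x.
    by case: (leP (a + r)) => h /=; rewrite ?mulr1 ?mulr0; case: (ler0P (f x - a)); lra.
  by rewrite meanD ?meanZ ?mean_cst ?mean_indic ?[P _]Pr ?mulr0 ?addr0//; bounded.
apply/eqP; rewrite eq_le mean_ge0// andbT.
apply: (@le0_half_power _ _ 2) => n.
have := small (2 ^- n) ltac:(by rewrite invr_gt0 exprn_gt0).
by rewrite meanD ?meanB ?mean_cst ?subrr ?addr0//; bounded.
Qed.

End action_facts.

Section mean_ergodic.
Context (R : realType) (Gamma : groupType) (c : pmp_action R Gamma).
Local Notation P := (sps_prob c).
Local Notation E f := (\int[P]_x f x).
Implicit Types (f : c -> R) (g h : Gamma) (s : seq Gamma).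

(** The average runs over a list, not a finite set: repetitions act as weights and make the averages
    closed under midpoints. *)
Definition orbit_average s f (x : c) : R :=
  (\sum_(g <- s) f (act c g x)) / (size s)%:R.

Lemma bounded_measurable_orbit_average s f : bounded_measurable f ->
  bounded_measurable (orbit_average s f).
Proof.
move=> bf; rewrite /orbit_average; apply: bounded_measurableM; last by bounded.
by apply: bounded_measurable_sum => g; exact: bounded_measurable_act.
Qed.

Lemma mean_orbit_average s f : s != [::] -> bounded_measurable f ->
  E (orbit_average s f) = E f.
Proof.
move=> s0 bf.
have bfg g := bounded_measurable_act g bf.
have sR : (size s)%:R != 0 :> R by rewrite pnatr_eq0 size_eq0.
transitivity (E (fun x => (size s)%:R^-1 * \sum_(g <- s) f (act c g x))).
  by apply: eq_Rintegral => x _; rewrite mulrC.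
rewrite meanZ; last by bounded.
rewrite mean_sum; last by [].
rewrite (eq_bigr (fun=> E f)); last by move=> g _; exact: mean_act.
rewrite big_const_seq count_predT iter_addr_0 -[X in _ * X]mulr_natl.
by rewrite mulrA mulVf ?mul1r.
Qed.

Lemma orbit_average_itv s f : s != [::] -> (forall x, 0 <= f x <= 1) ->
  forall x, 0 <= orbit_average s f x <= 1.
Proof.
move=> s0 f01 x; have sR : 0 < (size s)%:R :> R by rewrite ltr0n lt0n size_eq0.
rewrite /orbit_average; apply/andP; split.
  by apply: divr_ge0 => //; apply: sumr_ge0 => g _; have /andP[] := f01 (act c g x).
rewrite ler_pdivrMr// mul1r.
apply: (@le_trans _ _ (\sum_(g <- s) 1)).
  by apply: ler_sum => g _; have /andP[] := f01 (act c g x).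
by rewrite big_const_seq count_predT iter_addr_0.
Qed.

Lemma orbit_average_act s f g x :
  orbit_average s f (act c g x) = orbit_average [seq (h * g)%g | h <- s] f x.
Proof.
rewrite /orbit_average size_map big_map; congr (_ / _).
by apply: eq_bigr => h _; rewrite act_M.
Qed.

(** Repeating [s] as many times as [t] has terms, and conversely, gives both lists the same
    weight. *)
Lemma orbit_average_midpoint s t f : s != [::] -> t != [::] ->
  exists2 w, w != [::] & forall x, orbit_average w f x =
    (orbit_average s f x + orbit_average t f x) / 2.
Proof.
move=> s0 t0; exists (flatten (nseq (size t) s) ++ flatten (nseq (size s) t)).
  by case: s t s0 t0 => [//|g s] [//|h t].
move=> x; rewrite /orbit_average big_cat/= !big_flatten !big_nseq.
rewrite !iter_addr_0 size_cat !size_flatten /shape !map_nseq !sumn_nseq.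
have sR : (size s)%:R != 0 :> R by rewrite pnatr_eq0 size_eq0.
have tR : (size t)%:R != 0 :> R by rewrite pnatr_eq0 size_eq0.
have key (a b p q : R) : p != 0 -> q != 0 ->
    (a * q + b * p) / (p * q + q * p) = (a / p + b / q) / 2.
  move=> p0 q0; have -> : p * q + q * p = 2 * (p * q) by ring.
  by field; rewrite p0 q0.
rewrite natrD !natrM -[X in X + _]mulr_natr -[X in _ + X]mulr_natr.
exact: key.
Qed.

(* The averages of almost minimal L2 norm are almost equal, by the
   parallelogram identity, and their limit is invariant because the norm is. *)
Theorem mean_ergodic f (e : R) : countable [set: Gamma] -> ergodic c ->
  measurable_fun setT f -> (forall x, 0 <= f x <= 1) -> 0 < e ->
  exists2 s, s != [::] & E (fun x => (orbit_average s f x - E f) ^+ 2) <= e.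
Proof.
move=> Gcount erg mf f01 e0.
have bf : bounded_measurable f.
  by split => //; exists 1 => x; have /andP[? ?] := f01 x; rewrite ger0_norm.
have bav s := bounded_measurable_orbit_average s bf.
pose N2 s := E (fun x => orbit_average s f x ^+ 2).
pose D := [set N2 s | s in [set s | s != [::]]].
have D0 : has_inf D.
  split; first by exists (N2 [:: 1%g]), [:: 1%g].
  by exists 0 => _ [s _ <-]; apply: mean_ge0 => x; exact: sqr_ge0.
have close s t (r : R) : s != [::] -> t != [::] -> N2 s <= inf D + r ->
    N2 t <= inf D + r ->
    E (fun x => (orbit_average s f x - orbit_average t f x) ^+ 2) <= 4 * r.
  move=> s0 t0 sr tr.
  have [w w0 wE] := orbit_average_midpoint f s0 t0.
  have wD : inf D <= N2 w by apply: ge_inf; [case: D0|exists w].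
  have -> : E (fun x => (orbit_average s f x - orbit_average t f x) ^+ 2) =
      2 * N2 s + 2 * N2 t - 4 * N2 w.
    rewrite /N2 -!meanZ -?meanD -?meanB; try bounded.
    by apply: eq_Rintegral => x _; rewrite wE; field.
  by lra.
(* With this precision consecutive averages have squared L2 distance at most 4 ^- n, hence L1
   distance at most 2 ^- n, as [fast_L1_limit] requires. *)
have /choice[S SP] : forall n, exists s, s != [::] /\ N2 s <= inf D + 4 ^- n.+1.
  move=> n.
  have e4 : 0 < 4 ^- n.+1 :> R by rewrite invr_gt0 exprn_gt0.
  by have [_ [s s0 <-] /ltW sn] := inf_adherent e4 D0; exists s.
pose v n := orbit_average (S n) f.
have bv n : bounded_measurable (v n) by exact: bav.
have sqrt_close n u : bounded_measurable u -> E (fun x => u x ^+ 2) <= 4 * 4 ^- n.+1 ->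
    E (fun x => `|u x|) <= 2 ^- n.
  move=> bu hu; rewrite -(@ler_pXn2r _ 2)// ?nnegrE ?mean_ge0// ?invr_ge0 ?exprn_ge0//.
  apply: le_trans (mean_sqr_le _ (bounded_measurable_norm bu)) _.
  rewrite (_ : E (fun x => `|u x| ^+ 2) = E (fun x => u x ^+ 2)).
    apply: le_trans hu _; rewrite exprS invfM mulrA divff ?mul1r//.
    by rewrite (_ : 4 = 2 * 2 :> R) ?exprMn ?invfM -?expr2//; ring.
  by apply: eq_Rintegral => x _; rewrite real_normK ?num_real.
have Sn1 n : N2 (S n.+1) <= inf D + 4 ^- n.+1.
  apply: le_trans (SP n.+1).2 _; rewrite lerD2l lef_pV2 ?posrE ?exprn_gt0//.
  by rewrite ler_weXn2l// ler1n.
have [h [mh h01 hv]] : exists h : c -> R, [/\ measurable_fun setT h,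
    forall x, 0 <= h x <= 1 & forall n, E (fun x => `|v n x - h x|) <= 2 * 2 ^- n].
  apply: fast_L1_limit => [n|n|n].
  - by case: (bv n).
  - exact: orbit_average_itv (SP n).1 f01.
  - apply: sqrt_close; first by bounded.
    by apply: close; [exact: (SP n.+1).1|exact: (SP n).1|exact: Sn1|exact: (SP n).2].
have bh : bounded_measurable h.
  by split => //; exists 1 => x; have /andP[? ?] := h01 x; rewrite ger0_norm.
have bhg g := bounded_measurable_act g bh.
have bvg n g := bounded_measurable_act g (bv n).
have h_const : E (fun x => `|h x - E h|) = 0.
  apply: ergodic_invariant_constant => //; first by move=> x; have /andP[] := h01 x.
  move=> g; apply/eqP; rewrite eq_le mean_ge0// andbT.
  apply: (@le0_half_power _ _ 5) => n.
  have h1 : E (fun x => `|v n (act c g x) - h (act c g x)|) <= 2 * 2 ^- n.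
    by rewrite (mean_act g (f := fun x => `|v n x - h x|))//; bounded.
  (* A translate of [v n] is the average over a translated list and has the same norm, so [close]
     applies to the two. *)
  have h2 : E (fun x => `|v n (act c g x) - v n x|) <= 2 ^- n.
    apply: sqrt_close; first by bounded.
    under eq_Rintegral do rewrite /v orbit_average_act.
    apply: close; [|exact: (SP n).1| |exact: (SP n).2].
      by rewrite -size_eq0 size_map size_eq0; exact: (SP n).1.
    apply: le_trans (SP n).2; rewrite /N2.
    under eq_Rintegral do rewrite -orbit_average_act.
    by rewrite (mean_act g (f := fun x => v n x ^+ 2))//; bounded.
  apply: (@le_trans _ _ (E (fun x => `|v n (act c g x) - h (act c g x)| +
      `|v n (act c g x) - v n x| + `|v n x - h x|))).
    apply: le_mean; try bounded.
    move=> x; rewrite (distrC (v n (act c g x)) (h _)).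
    rewrite (le_trans (ler_distD (v n (act c g x)) _ _))// -addrA lerD2l.
    exact: ler_distD.
  rewrite !meanD; try bounded.
  by have := hv n; lra.
have hf : E h = E f.
  apply/eqP; rewrite -subr_eq0 -normr_le0; apply: (@le0_half_power _ _ 2) => n.
  apply: le_trans (hv n); rewrite distrC.
  rewrite -(mean_orbit_average (SP n).1 bf) -/(v n) -meanB//.
  apply: le_normr_Rintegral => //; apply: bounded_integrable; bounded.
have [n ne] := half_power_lt (divr_gt0 e0 (ltr0Sn R 1)).
exists (S n); first exact: (SP n).1.
(* As [v n] and [E f] lie in [0, 1], the square is at most the absolute value, and L1 convergence is
   enough. *)
apply: (@le_trans _ _ (E (fun x => `|v n x - h x| + `|h x - E h|))).
  rewrite hf; apply: le_mean; try bounded.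
  move=> x; rewrite (le_trans _ (ler_distD _ _ _))// -/(v n).
  have /andP[v0 v1] : 0 <= v n x <= 1 := orbit_average_itv (SP n).1 f01 x.
  have f0 : 0 <= E f by apply: mean_ge0 => y; have /andP[] := f01 y.
  have f1 : E f <= 1.
    rewrite -[leRHS](mean_cst P 1); apply: le_mean => //; try bounded.
    by move=> y; have /andP[] := f01 y.
  move: (v n x) (E f) v0 v1 f0 f1 => a b a0 a1 b0 b1.
  by case: (ler0P (a - b)) => ab; nra.
rewrite meanD ?h_const ?addr0; try bounded.
by apply: le_trans (hv n) _; lra.
Qed.

End mean_ergodic.

(** * Products with the identity action *)

Lemma ecvg0P (R : realType) (u : nat -> R) :
  ((fun n => (u n)%:E) @ \oo --> 0%E) <->
  forall e, 0 < e -> exists N, forall n, (N <= n)%N -> `|u n| < e.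
Proof.
split => [/fine_cvgP[_ /cvgrPdist_lt h] e e0|h].
  have [N _ NP] := h e e0; exists N => n Nn.
  by have := NP n Nn; rewrite /= sub0r normrN.
apply: cvg_EFin; first exact: nearW.
apply/cvgrPdist_lt => e e0; have [N NP] := h e e0.
by exists N => // n Nn; rewrite /= sub0r normrN; exact: NP.
Qed.

Lemma indicY_norm (T : Type) (R : realDomainType) (A B : set T) x :
  \1_(A `+` B) x = `|\1_A x - \1_B x| :> R.
Proof.
rewrite !indicE /setY in_setU !in_setD.
case: (x \in A); case: (x \in B);
  by rewrite /= ?subrr ?subr0 ?sub0r ?normrN ?normr0 ?normr1.
Qed.

(** * Correlations of a set with its translates *)

Section correlation.
Context (R : realType) (Gamma : groupType).
Implicit Types (a b : pmp_action R Gamma) (g h : Gamma) (s : seq Gamma).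

(** This is mu(g^-1 A /\ A). Displacements of [A] and square deviations of its averages are affine
    in these numbers, which weak containment controls. *)
Definition correlation a (A : set a) g : R :=
  \int[sps_prob a]_x (\1_A (act a g x) * \1_A x).

Lemma bounded_measurable_indic_act a (A : set a) g : measurable A ->
  bounded_measurable (fun x => \1_A (act a g x) : R).
Proof.
move=> mA; apply: (bounded_measurable_act g (f := \1_A : a -> R)).
exact: bounded_measurable_indic.
Qed.

Lemma correlation1 a (A : set a) : measurable A ->
  correlation A 1%g = \int[sps_prob a]_x (\1_A x : R).
Proof.
move=> mA; apply: eq_Rintegral => x _.
by rewrite act_1 indicE -natrM mulnb andbb.
Qed.

Lemma fine_prob_image a (A B : set a) g : measurable A -> measurable B ->
  fine (sps_prob a ((act a g @` A) `&` B)) =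
  \int[sps_prob a]_x (\1_A (act a g^-1%g x) * \1_B x).
Proof.
move=> mA mB; rewrite -mean_indic; last first.
  by apply: measurableI => //; exact: measurable_act_image.
by apply: eq_Rintegral => x _; rewrite act_imageE indicI.
Qed.

Lemma prob_displacement a (A : set a) g : measurable A ->
  sps_prob a ((act a g @` A) `+` A) =
  (\int[sps_prob a]_x `|\1_A (act a g^-1%g x) - \1_A x : R|)%:E.
Proof.
move=> mA; have mgA := measurable_act_image g mA.
have mY : measurable ((act a g @` A) `+` A).
  by apply: measurableU; exact: measurableD.
rewrite -[LHS]fineK; last exact: fin_num_measure.
rewrite -mean_indic//; congr EFin; apply: eq_Rintegral => x _.
by rewrite indicY_norm act_imageE !indicE.
Qed.

(** The partition consists of [A] and its complement; the group elements are inverted because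
    [weakly_contained] uses images where [correlation] uses preimages. *)
Lemma weakly_contained_correlation a b (A : set a) s (e : R) :
  weakly_contained a b -> measurable A -> 0 < e ->
  exists2 B : set b, measurable B &
    forall g, g \in s -> `|correlation A g - correlation B g| < e.
Proof.
move=> ab mA e0.
pose part (i : 'I_2) := if i == ord0 then A else ~` A.
have partP : borel_partition part.
  split.
  - by move=> i; rewrite /part; case: ifP => // _; exact: measurableC.
  - apply/trivIsetP => i j _ _; rewrite /part.
    by case: i => -[|[|//]] ? ; case: j => -[|[|//]] ? //= _; rewrite ?setICr ?setICl.
  - apply/seteqP; split => // x _; have [Ax|nAx] := pselect (A x).
      by exists ord0.
    by exists (lift ord0 ord0).
have [B [mB _ _] BP] := ab 2 part partP [set g^-1%g | g in [set` s]]
  (finite_image _ (finite_seq _)) e e0.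
exists (B ord0) => // g gs.
have := BP g^-1%g ord0 ord0 ltac:(by exists g).
have -> : part ord0 = A by rewrite /part eqxx.
rewrite -(@fineK _ (sps_prob a _)); last first.
  by apply: fin_num_measure; apply: measurableI => //; exact: measurable_act_image.
rewrite -(@fineK _ (sps_prob b _)); last first.
  by apply: fin_num_measure; apply: measurableI => //; exact: measurable_act_image.
by rewrite !fine_prob_image// invgK -EFinB abse_EFin lte_fin.
Qed.

Lemma mean_displacement a (A : set a) g : measurable A ->
  \int[sps_prob a]_x `|\1_A (act a g x) - \1_A x : R| =
  2 * correlation A 1%g - 2 * correlation A g.
Proof.
move=> mA; have bA : bounded_measurable (\1_A : a -> R) by exact: bounded_measurable_indic.
have bAg := bounded_measurable_indic_act g mA.
rewrite correlation1//.
transitivity (\int[sps_prob a]_x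
  ((\1_A (act a g x) + \1_A x) - 2 * (\1_A (act a g x) * \1_A x) : R)).
  apply: eq_Rintegral => x _; rewrite !indicE.
  case: (_ \in _); case: (_ \in _); rewrite /= ?subrr ?subr0 ?sub0r ?normrN ?normr0 ?normr1; ring.
rewrite meanB ?meanD ?meanZ; try bounded.
rewrite (mean_act g (f := \1_A : a -> R))//.
by rewrite /correlation; ring.
Qed.

(** After expanding the square, invariance of the measure turns the product of the translates by [g]
    and [h] into the correlation at g h^-1. [m] is arbitrary because a model of a set is compared
    with the mean of the original set. *)
Lemma mean_average_sqr a (A : set a) s (m : R) : measurable A -> s != [::] ->
  \int[sps_prob a]_x ((orbit_average s (\1_A : a -> R) x - m) ^+ 2) =
  (\sum_(g <- s) \sum_(h <- s) correlation A (g * h^-1)%g) / (size s)%:R ^+ 2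
  - 2 * m * correlation A 1%g + m ^+ 2.
Proof.
move=> mA s0.
have bA : bounded_measurable (\1_A : a -> R) by exact: bounded_measurable_indic.
have bAg g := bounded_measurable_indic_act g mA.
have bav := bounded_measurable_orbit_average s bA.
transitivity (\int[sps_prob a]_x
   ((size s)%:R ^- 2 * (\sum_(g <- s) \sum_(h <- s)
       (\1_A (act a g x) * \1_A (act a h x)))
   - 2 * m * orbit_average s (\1_A : a -> R) x + m ^+ 2)).
  apply: eq_Rintegral => x _.
  rewrite (_ : \sum_(g <- s) _ = (\sum_(g <- s) \1_A (act a g x)) ^+ 2); last first.
    rewrite expr2 big_distrl/=; apply: eq_bigr => g _.
    by rewrite big_distrr.
  rewrite /orbit_average; set u := \sum_(_ <- _) _.
  by rewrite -exprVn -exprMn; ring.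
rewrite meanD ?meanB ?meanZ ?mean_cst//; try bounded.
rewrite mean_orbit_average// correlation1// mean_sum; last by move=> g; bounded.
rewrite mulrC; congr (_ / _ - _ + _); apply: eq_bigr => g _.
rewrite mean_sum; last by move=> h; bounded.
apply: eq_bigr => h _; rewrite /correlation.
rewrite -(mean_act h (f := fun x => \1_A (act a (g * h^-1)%g x) * \1_A x)).
  by apply: eq_Rintegral => x _; rewrite -act_M mulgVK.
by bounded.
Qed.

End correlation.

Lemma double_average_dist (R : numFieldType) (I : eqType) (s : seq I)
    (F G : I -> I -> R) (e : R) : s != [::] ->
  (forall i j, i \in s -> j \in s -> `|F i j - G i j| <= e) ->
  `|(\sum_(i <- s) \sum_(j <- s) F i j) / (size s)%:R ^+ 2 -
    (\sum_(i <- s) \sum_(j <- s) G i j) / (size s)%:R ^+ 2| <= e.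
Proof.
move=> s0 FG; have sR : 0 < (size s)%:R :> R by rewrite ltr0n lt0n size_eq0.
rewrite -mulrBl normrM normfV (ger0_norm (exprn_ge0 _ (ltW sR))).
rewrite ler_pdivrMr ?exprn_gt0// -sumrB.
apply: le_trans (ler_norm_sum _ _ _) _.
rewrite (_ : e * _ = \sum_(i <- s) \sum_(j <- s) e); last first.
  by rewrite !big_const_seq !count_predT !iter_addr_0 expr2 mulrA !mulr_natr.
rewrite big_seq [leRHS]big_seq; apply: ler_sum => i si.
rewrite -sumrB; apply: le_trans (ler_norm_sum _ _ _) _.
by rewrite big_seq [leRHS]big_seq; apply: ler_sum => j sj; exact: FG.
Qed.

(** By Tonelli: were all section integrals at least [r], the double integral would be too. *)
Lemma exists_slice d1 d2 (X : measurableType d1) (Y : measurableType d2)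
  (R : realType) (P : probability X R) (Q : probability Y R)
  (F : X * Y -> R) (r : R) : bounded_measurable F -> (forall z, 0 <= F z) ->
  \int[(P \x Q)%E]_z F z < r ->
  exists x, bounded_measurable (fun y => F (x, y)) /\
    \int[Q]_y F (x, y) < r.
Proof.
move=> bF F0 Fr; have [mF [M FM]] := bF.
have bFx x : bounded_measurable (fun y => F (x, y)).
  split; last by exists M => y; exact: FM.
  by apply: (measurableT_comp mF); exact: measurable_pair1.
apply: contrapT => /forallNP h.
have {}h x : r <= \int[Q]_y F (x, y).
  by rewrite leNgt; apply/negP => lt; apply: (h x).
suff : (r%:E <= \int[(P \x Q)%E]_z (F z)%:E)%E.
  by rewrite -(mean_EFin (P \x Q)%E bF) lee_fin leNgt Fr.
rewrite (fubini_tonelli1 (EFin \o F)) => //; last first.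
  exact/measurable_EFinP.
apply: (@le_trans _ _ (\int[P]_x (r%:E))%E).
  by rewrite integral_cst// [X in (_ * X)%E](probability_setT P) mule1.
apply: ge0_le_integral => //.
- by move=> x _; rewrite lee_fin ltW// (le_lt_trans _ Fr)// mean_ge0.
- apply: (measurable_fun_fubini_tonelli_F (EFin \o F)) => //.
  exact/measurable_EFinP.
- by move=> x _; rewrite /fubini_F -(mean_EFin Q (bFx x)) lee_fin.
Qed.

(** * Sections of sets in the product with the identity action *)

Section slices.
Context (R : realType) (Gamma : groupType) (X : std_prob_space R).
Context (b : pmp_action R Gamma).
Local Notation a := (prod_action (identity_action Gamma X) b).


Lemma correlation_cylinder (D : set X) g : measurable D ->
  correlation (D `*` setT : set a) g = fine (sps_prob X D).
Proof.
move=> mD; have mDT : measurable (D `*` [set: b]) by exact: measurableX.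
transitivity (\int[sps_prob a]_z (\1_(D `*` [set: b] : set a) z : R)).
  apply: eq_Rintegral => z _; rewrite !indicE.
  have -> : (act a g z \in D `*` [set: b]) = (z \in D `*` [set: b]).
    by apply/idP/idP; rewrite !inE.
  by rewrite -natrM mulnb andbb.
rewrite mean_indic//; congr fine.
by rewrite [LHS]product_measure1E// [X in (_ * X)%E](probability_setT (sps_prob b)) mule1.
Qed.

(* In [a] the first coordinate is fixed, so averages over [Gamma] do not mix
   the sections of a set: if they are almost constant, then almost every
   section has nearly the mean measure. *)
Lemma almost_invariant_section (c : pmp_action R Gamma) (D : set X)
    (s : seq Gamma) (r : R) :
  countable [set: Gamma] -> ergodic c -> weakly_contained a c ->
  weakly_contained c a -> measurable D -> 0 < r ->
  exists C : set b, [/\ measurable C,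
    `|fine (sps_prob b C) - fine (sps_prob X D)| <= 2 * r &
    forall g, g \in s ->
      \int[sps_prob b]_y `|\1_C (act b g y) - \1_C y : R| <= r].
Proof.
move=> Gcount erg ac ca mD r0.
(* A square deviation below r ^+ 2 puts the error in measure below [r]; for r <= 1 the same bound
   also serves the displacements. *)
wlog r1 : r r0 / r <= 1.
  move=> h; have [r1|r1] := leP r 1; first exact: (h r r0 r1).
  have [C [mC Cp Cs]] := h 1 ltr01 (lexx 1).
  exists C; split => //; first by apply: le_trans Cp _; lra.
  by move=> g gs; apply: le_trans (Cs g gs) (ltW r1).
set p := fine _.
pose k : R := (size s)%:R.
have k0 : 0 <= k by [].
(* Passing twice between actions with tolerance [e] makes each of the [k] displacements at most 8e
   and the square deviation at most 5e; taking 6 for 5 keeps the final inequality strict. *)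
pose e := r ^+ 2 / (8 * k + 6).
have e0 : 0 < e by rewrite divr_gt0 ?exprn_gt0// ltr_wpDl// mulr_ge0.
have ek : (8 * k + 6) * e = r ^+ 2.
  by rewrite mulrC divfK// gt_eqF// ltr_wpDl// mulr_ge0.
have mDT : measurable (D `*` [set: b]) by exact: measurableX.
have [A mA AP] := weakly_contained_correlation (A := D `*` setT : set a)
  (1%g :: s) ac mDT e0.
have bA : bounded_measurable (\1_A : c -> R) by exact: bounded_measurable_indic.
have iA x : 0 <= (\1_A x : R) <= 1 by rewrite indicE; case: (_ \in _); rewrite /= ?lexx ?ler01.
pose m := \int[sps_prob c]_x (\1_A x : R).
have m0 : 0 <= m by apply: mean_ge0 => x; have /andP[] := iA x.
have m1 : m <= 1.
  rewrite -[leRHS](mean_cst (sps_prob c) 1); by apply: le_mean => //; bounded.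
have [w w0 wP] := mean_ergodic Gcount erg (proj1 bA) iA e0.
(* The elements [1] and [s] control the measure and the displacements; the quotients g h^-1 are
   those in the square deviation of the average over [w]. *)
have [B mB BP] := weakly_contained_correlation
  (1%g :: s ++ [seq (g * h^-1)%g | g <- w, h <- w]) ca mA e0.
have bB : bounded_measurable (\1_B : a -> R) by exact: bounded_measurable_indic.
have bBg g := bounded_measurable_indic_act g mB.
have bav := bounded_measurable_orbit_average w bB.
have bdisp g : bounded_measurable (fun z : a => `|\1_B (act a g z) - \1_B z : R|).
  by bounded.
have B1 : `|m - correlation B 1%g| < e by have := BP 1%g (mem_head _ _); rewrite correlation1.
have A1 : `|p - m| < e.
  by have := AP 1%g (mem_head _ _); rewrite correlation_cylinder// correlation1.
(* All defects are nonnegative and added into one function, so that one section is good for all of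
   them at once. *)
pose F (z : a) := \sum_(g <- s) `|\1_B (act a g z) - \1_B z : R| +
  (orbit_average w (\1_B : a -> R) z - m) ^+ 2.
have FE : \int[sps_prob a]_z F z < r ^+ 2.
  rewrite meanD; try bounded.
  rewrite mean_sum//.
  apply: (@le_lt_trans _ _ (8 * k * e + 5 * e)); last by rewrite -ek; lra.
  apply: lerD.
    rewrite (_ : 8 * k * e = \sum_(g <- s) (8 * e)); last first.
      by rewrite big_const_seq count_predT iter_addr_0 -mulr_natr; ring.
    rewrite big_seq [leRHS]big_seq; apply: ler_sum => g gs.
    rewrite mean_displacement//.
    have := BP g ltac:(by rewrite inE mem_cat gs orbT).
    have := AP g ltac:(by rewrite inE gs orbT).
    rewrite correlation_cylinder// -/p; move: A1 B1.
    rewrite !ltr_norml => /andP[? ?] /andP[? ?] /andP[? ?] /andP[? ?]; lra.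
  move: wP; rewrite !mean_average_sqr// -/m.
  rewrite [X in _ - _ * X + _](correlation1 mA) -/m.
  set u := _ / _; set v := _ / _.
  have uv : `|v - u| <= e.
    rewrite distrC; apply: double_average_dist => // g h gw hw; apply/ltW/BP.
    have gh : (g * h^-1)%g \in [seq (g * h^-1)%g | g <- w, h <- w].
      by apply/allpairsP; exists (g, h).
    by rewrite inE mem_cat gh !orbT.
  move: uv B1; rewrite ler_norml ltr_norml => /andP[? ?] /andP[? ?] ?.
  by nra.
have [x [bx Fx]] := exists_slice (P := sps_prob X) (Q := sps_prob b)
  (F := F) ltac:(by bounded) ltac:(by move=> z; rewrite addr_ge0 ?sqr_ge0 ?sumr_ge0) FE.
pose C : set b := xsection B x.
have mC : measurable C by exact: measurable_xsection.
have bC : bounded_measurable (\1_C : b -> R) by exact: bounded_measurable_indic.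
have bCg g := bounded_measurable_indic_act g mC.
have bavC := bounded_measurable_orbit_average w bC.
have CB y : \1_C y = \1_B (x, y) :> R by rewrite !indicE mem_xsection.
have disp y g : \1_C (act b g y) - \1_C y = \1_B (act a g (x, y)) - \1_B (x, y) :> R.
  by rewrite !CB.
have avC y : orbit_average w (\1_C : b -> R) y = orbit_average w (\1_B : a -> R) (x, y).
  by rewrite /orbit_average; congr (_ / _); apply: eq_bigr => g _; rewrite CB.
have r2 : r ^+ 2 <= r by rewrite expr2 ler_piMl// ltW.
exists C; split => //.
  rewrite -mean_indic//.
  have e1 : e <= r by have := mulr_ge0 k0 (ltW e0); move: ek r2 e0; clear; lra.
  (* The averages of [C] have the same mean as [C], so Jensen's inequality bounds the squared error
     by the square deviation. *)
  have mC1 : `|\int[sps_prob b]_y (\1_C y : R) - m| <= r.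
    rewrite -(@ler_pXn2r _ 2)// ?nnegrE ?(ltW r0)// real_normK ?num_real//.
    apply: le_trans (ltW Fx).
    rewrite -(mean_orbit_average w0 bC) -[X in _ - X](mean_cst (sps_prob b) m) -meanB; try bounded.
    apply: le_trans (mean_sqr_le _ _) _; first by bounded.
    apply: le_mean; try bounded.
    by move=> y; rewrite avC /F lerDr sumr_ge0.
  rewrite (le_trans (ler_distD m _ _))// (_ : 2 * r = r + r); last by ring.
  by rewrite lerD// distrC (le_trans (ltW A1)).
move=> g gs; apply: le_trans r2; apply: le_trans (ltW Fx).
apply: le_mean => //; first by bounded.
move=> y; rewrite disp /F; rewrite (big_rem g)//= -addrA lerDl.
by rewrite addr_ge0 ?sqr_ge0 ?sumr_ge0.
Qed.

End slices.

(** Non-atomicity supplies [D] with measure [p] strictly between 0 and 1. The sections [C n] become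
    invariant under more and more of an enumeration of [Gamma] while their measures tend to [p], so
    the products in [strongly_ergodic] tend to p (1 - p), which is not 0. *)
Lemma not_weakly_equivalent_ergodic (R : realType) (Gamma : groupType)
    (X : std_prob_space R) (b c : pmp_action R Gamma) :
  countable [set: Gamma] -> nonatomic X -> strongly_ergodic b -> ergodic c ->
  ~ weakly_equivalent (prod_action (identity_action Gamma X) b) c.
Proof.
move=> Gcount Xna sb erg [ac ca].
have /countable_injP[e einj] := Gcount.
have [v vK] := countable_retraction 1%g einj.
have [D [mD _ D0 D1]] := Xna setT measurableT
  ltac:(by rewrite [X in (_ < X)%E]probability_setT lte01).
rewrite [X in (_ < X)%E]probability_setT in D1.
have [p pE] : exists p : R, sps_prob X D = p%:E.
  by exists (fine (sps_prob X D)); rewrite fineK// fin_num_measure.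
rewrite pE lte_fin in D0; rewrite pE lte_fin in D1.
have /choice[C CP] : forall n, exists C : set b, [/\ measurable C,
    `|fine (sps_prob b C) - p| <= 2 * 2 ^- n &
    forall g, (e g < n)%N ->
      \int[sps_prob b]_y `|\1_C (act b g y) - \1_C y : R| <= 2 ^- n].
  move=> n.
  have n0 : 0 < 2 ^- n :> R by rewrite invr_gt0 exprn_gt0.
  have [C [mC Cp Cs]] := almost_invariant_section [seq v i | i <- iota 0 n]
    Gcount erg ac ca mD n0.
  exists C; split => //; first by rewrite pE in Cp.
  move=> g gn; apply: Cs; apply/mapP; exists (e g); last by rewrite vK.
  by rewrite mem_iota.
have bC n : bounded_measurable (\1_(C n) : b -> R).
  by apply: bounded_measurable_indic; case: (CP n).
have := sb C ltac:(by move=> n; case: (CP n)) _.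
have -> : (fun n => sps_prob b (C n) * (1 - sps_prob b (C n)))%E =
    (fun n => (fine (sps_prob b (C n)) * (1 - fine (sps_prob b (C n))))%:E).
  apply/funext => n; have [mC _ _] := CP n.
  by rewrite -[in LHS](@fineK _ (sps_prob b _)) ?fin_num_measure.
move=> h; have /ecvg0P{}h : (fun n => (fine (sps_prob b (C n)) *
    (1 - fine (sps_prob b (C n))))%:E) @ \oo --> 0%E.
  apply: h => g.
  have -> : (fun n => sps_prob b ((act b g @` C n) `+` C n)) =
      (fun n => (\int[sps_prob b]_y `|\1_(C n) (act b g^-1%g y) - \1_(C n) y : R|)%:E).
    by apply/funext => n; rewrite prob_displacement//; case: (CP n).
  apply/ecvg0P => r r0; have [N Nr] := half_power_lt r0.
  exists (maxn N (e g^-1%g).+1) => n; rewrite geq_max => /andP[Nn gn].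
  have [_ _ /(_ _ gn) h1] := CP n.
  rewrite ger0_norm ?mean_ge0//; apply: le_lt_trans h1 _; apply: le_lt_trans Nr.
  by rewrite lef_pV2 ?posrE ?exprn_gt0// ler_weXn2l// ler1n.
(* The function q (1 - q) is 1-Lipschitz on [0, 1]: once 2 ^- n is below this number, the error 2 *
   2 ^- n leaves q (1 - q) above p (1 - p) / 2. *)
have r0 : 0 < p * (1 - p) / 4 by rewrite divr_gt0// mulr_gt0// subr_gt0.
have [N NP] := h _ r0.
have [M Mr] := half_power_lt r0.
set n := maxn N M.
have [mC Cp _] := CP n.
have := NP n (leq_maxl N M).
have : 2 ^- n <= 2 ^- M :> R.
  by rewrite lef_pV2 ?posrE ?exprn_gt0// ler_weXn2l ?ler1n// leq_maxr.
have : 0 <= fine (sps_prob b (C n)) by exact/fine_ge0/measure_ge0.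
have : fine (sps_prob b (C n)) <= 1.
  by rewrite -lee_fin fineK ?fin_num_measure// probability_le1.
move: Mr Cp D0 D1; clear.
move: (fine _) (2 ^- n) (2 ^- M) => q s t.
rewrite !ler_norml ltr_norml => h1 /andP[h2 h3] p0 p1 q1 q0 st /andP[h4 h5].
case: (lerP p q) => pq.
  have : 0 <= (q - p) * (2 - q - p) by rewrite mulr_ge0; lra.
  nra.
have : 0 <= (p - q) * (q + p) by rewrite mulr_ge0; lra.
nra.
Qed.

(** * Invariant means *)

(** By compactness, sequences in [0, 1] converge along an ultrafilter containing the tails, and
    additivity and invariance survive. The limit is taken set by set, so [N] may depend on [A]. *)
Lemma amenable_of_almost_invariant_means (R : realType) (Gamma : groupType)
    (m : nat -> set Gamma -> R) :
  (forall n A, 0 <= m n A) -> (forall n, m n setT = 1) ->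
  (forall n A B, A `&` B = set0 -> m n (A `|` B) = m n A + m n B) ->
  (forall g A e, 0 < e -> exists N, forall n, (N <= n)%N ->
     `|m n [set (g * h)%g | h in A] - m n A| < e) ->
  amenable R Gamma.
Proof.
move=> m0 m1 mD minv.
have [U [Uultra Uoo]] := ultraFilterLemma eventually_filter.
have UF : Filter U by exact: _.
have m01 n A : m n A <= 1.
  have : m n (A `|` ~` A) = 1 by rewrite setUv.
  by rewrite mD ?setICr// => <-; rewrite lerDl.
have /choice[l lP] : forall A, exists l, [set` `[0 : R, 1]] l /\ (m ^~ A @ U) --> l.
  move=> A.
  have mU : U (m ^~ A @^-1` [set` `[0 : R, 1]]).
    by apply: filterE => n; rewrite /= in_itv /=; apply/andP; split; [exact: m0|exact: m01].
  have [l [l01 lcl]] := @segment_compact R 0 1 (m ^~ A @ U) _ mU.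
  exists l; split => // V Vl.
  have [//|UC] := in_ultra_setVsetC (m ^~ A @^-1` V) Uultra.
  by have [x [nVx Vx]] := lcl (~` V) V UC Vl.
exists l; split.
- by move=> A; have [] := lP A; rewrite /= in_itv /= => /andP[].
- have [_ h] := lP setT.
  apply: (cvg_unique _ h) => //.
  rewrite (_ : m ^~ setT = fun=> 1); first exact: cvg_cst.
  by apply/funext.
- move=> A B AB; have [_ hA] := lP A; have [_ hB] := lP B.
  have [_ h] := lP (A `|` B); apply: (cvg_unique _ h) => //.
  rewrite (_ : m ^~ (A `|` B) = fun n => m n A + m n B); first exact: cvgD.
  by apply/funext => n; exact: mD.
- move=> g A; have [_ hA] := lP A; have [_ h] := lP [set (g * h)%g | h in A].
  apply: (cvg_unique _ h) => //.
  rewrite (_ : m ^~ _ = fun n => (m n [set (g * h)%g | h in A] - m n A) + m n A); last first.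
    by apply/funext => n; rewrite subrK.
  rewrite -(add0r (l A)); apply: cvgD => //.
  apply/cvgrPdist_lt => e e0; have [N NP] := minv g A e e0.
  apply: Uoo; exists N => // n Nn; rewrite /= sub0r normrN; exact: NP.
Qed.

(** * Walsh functions *)

Section binary_digits.
Context {R : realType}.
Implicit Type y : R.
Local Notation P := (uniform_prob (@ltr01 R)).

(* The minimum makes the digits of [1] all equal to one. *)
Definition dyadic n y : nat := minn (Num.truncn (2 ^+ n * y)) (2 ^ n).-1.

Lemma dyadic_lt n y : (dyadic n y < 2 ^ n)%N.
Proof. by have := expn_gt0 2 n; rewrite /dyadic; lia. Qed.

Lemma dyadic_divS n y : (dyadic n.+1 y %/ 2 = dyadic n y)%N.
Proof.
suff h : (Num.truncn (2 ^+ n.+1 * y) %/ 2 = Num.truncn (2 ^+ n * y))%N.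
  by rewrite /dyadic -h expnS; have := expn_gt0 2 n; lia.
rewrite exprS -mulrA; set z := 2 ^+ n * y.
have [z0|z0] := leP 0 z; last first.
  have /eqP-> : Num.truncn z == 0%N by rewrite -leqn0 truncn_le_nat; lra.
  by have /eqP-> // : Num.truncn (2 * z) == 0%N by rewrite -leqn0 truncn_le_nat; lra.
apply/esym/eqP; rewrite truncn_eq//.
have z20 : 0 <= 2 * z by lra.
have /andP[] := truncn_itv z20; set q := Num.truncn _ => h1 h2.
have h3 : ((2 * (q %/ 2))%N%:R : R) <= q%:R by rewrite ler_nat; lia.
have h4 : (q.+1%:R : R) <= (2 * (q %/ 2).+1)%N%:R by rewrite ler_nat; lia.
by move: h3 h4; rewrite !natrM; lra.
Qed.

Lemma dyadic_div m n y : (m <= n)%N -> (dyadic n y %/ 2 ^ (n - m) = dyadic m y)%N.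
Proof.
move=> mn; rewrite -(subnK mn); move: (n - m)%N => k {mn n}; rewrite addnK.
elim: k => [|k IH]; first by rewrite divn1.
by rewrite addSn expnS divnMA dyadic_divS.
Qed.

Lemma dyadic_bounds n y : 0 <= y <= 1 ->
  (dyadic n y)%:R / 2 ^+ n <= y <= (dyadic n y).+1%:R / 2 ^+ n.
Proof.
move=> /andP[y0 y1]; have p0 : 0 < 2 ^+ n :> R by rewrite exprn_gt0.
have z0 : 0 <= 2 ^+ n * y by rewrite mulr_ge0// ltW.
have z1 : 2 ^+ n * y <= 2 ^+ n by rewrite ler_piMr// ltW.
rewrite ler_pdivrMr// ler_pdivlMr// (mulrC y) /dyadic.
have /andP[t1 t2] := truncn_itv z0.
have pE : (2 ^ n).-1.+1%:R = 2 ^+ n :> R by rewrite prednK ?expn_gt0// natrX.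
have [h|/ltnW h] := leqP (Num.truncn (2 ^+ n * y)) (2 ^ n).-1.
  by rewrite t1 ltW.
rewrite pE z1 andbT; apply: le_trans t1.
by rewrite ler_nat.
Qed.

Lemma dyadic_eq n q y : (q < 2 ^ n)%N -> q%:R / 2 ^+ n <= y < q.+1%:R / 2 ^+ n ->
  dyadic n y = q.
Proof.
have p0 : 0 < 2 ^+ n :> R by rewrite exprn_gt0.
move=> qn; rewrite ler_pdivrMr// ltr_pdivlMr// (mulrC y) => /andP[h1 h2].
rewrite /dyadic (_ : Num.truncn _ = q); first by lia.
by apply/eqP; rewrite truncn_eq ?h1//; apply: le_trans h1.
Qed.

Lemma measurable_dyadic n : measurable_fun setT (dyadic n).
Proof.
have p0 : 0 < 2 ^+ n :> R by rewrite exprn_gt0.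
have mge q : measurable [set y | (q <= dyadic n y)%N].
  case: q => [|q]; first by rewrite (_ : [set _ | _] = setT)//; apply/seteqP.
  have [qn|qn] := leqP q.+1 (2 ^ n).-1; last first.
    rewrite (_ : [set _ | _] = set0)//; rewrite -subset0 => y /=.
    by rewrite /dyadic; lia.
  rewrite (_ : [set _ | _] = `[(q.+1%:R / 2 ^+ n : R), +oo[%classic)//.
  apply/seteqP; split => y /=; rewrite in_itv /= andbT ler_pdivrMr// (mulrC y);
      rewrite /dyadic leq_min qn andbT.
    move=> h; rewrite -truncn_ge_nat//.
    by move: (leq_trans (ltn0Sn q) h); rewrite truncn_gt0; apply: le_trans.
  by move=> h; rewrite truncn_ge_nat//; apply: le_trans h.
apply: measurable_fun_to_nat => q.
rewrite (_ : [set _ | _] = [set y | (q <= dyadic n y)%N] `\`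
  [set y | (q.+1 <= dyadic n y)%N]); first exact: measurableD.
by apply/seteqP; split => y /=; [move=> <-; split; lia|lia].
Qed.

Lemma measurable_dyadic_level n q : measurable [set y | dyadic n y = q].
Proof.
rewrite -[X in measurable X]setTI.
exact: (measurable_dyadic n measurableT (Y := [set q])).
Qed.

Lemma dyadic_prob n q : (q < 2 ^ n)%N -> P [set y | dyadic n y = q] = (2 ^- n)%:E.
Proof.
move=> qn; have p0 : 0 < 2 ^+ n :> R by rewrite exprn_gt0.
have mq := measurable_dyadic_level n q.
have q3 : q%:R / 2 ^+ n < q.+1%:R / 2 ^+ n :> R.
  by rewrite ltr_pM2r ?invr_gt0// ltr_nat.
have q2 : 0 <= q%:R / 2 ^+ n :> R by rewrite divr_ge0// ltW.
have q1 : q.+1%:R / 2 ^+ n <= 1 :> R.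
  by rewrite ler_pdivrMr// mul1r -natrX ler_nat.
have len : (2 ^- n = q.+1%:R / 2 ^+ n - q%:R / 2 ^+ n :> R).
  by rewrite -mulrBl -[q.+1%:R]natr1 addrAC subrr add0r mul1r.
(* Within [0, 1] the level set is a half-open interval, except that the last one also contains 1;
   the half-open and the closed interval have the same length. *)
rewrite uniform01E//; apply/eqP; rewrite eq_le; apply/andP; split.
  apply: (@le_trans _ _ (lebesgue_measure `[(q%:R / 2 ^+ n : R), q.+1%:R / 2 ^+ n])).
    apply: le_measure; rewrite ?inE//; first exact: measurableI.
    move=> y /= [<-]; rewrite !in_itv /=; exact: dyadic_bounds.
  by rewrite lebesgue_measure_itv/= lte_fin q3 -EFinD -len.
apply: (@le_trans _ _ (lebesgue_measure `[(q%:R / 2 ^+ n : R), q.+1%:R / 2 ^+ n[)).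
  by rewrite lebesgue_measure_itv/= lte_fin q3 -EFinD -len.
apply: le_measure; rewrite ?inE//; first exact: measurableI.
move=> y /=; rewrite !in_itv /= => yq; split; first exact: dyadic_eq.
case/andP: yq => h1 h2; rewrite (le_trans q2)//=; apply/ltW/(lt_le_trans h2 q1).
Qed.

Definition digit n y : bool := odd (dyadic n.+1 y).

Lemma digit_dyadic n y : dyadic n.+1 y = (2 * dyadic n y + digit n y)%N.
Proof. by rewrite -(dyadic_divS n y) /digit; lia. Qed.

(** The digit of rank [n] is independent of the earlier ones: on each dyadic cell of order [n], the
    value prescribed by [H] selects one half of the cell. *)
Lemma digit_prob n (H : nat -> bool) :
  P [set y | digit n y = H (dyadic n y)] = (2^-1)%:E.
Proof.
have mset k (D : set nat) : measurable (dyadic k @^-1` D).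
  by rewrite -[X in measurable X]setTI; exact: measurable_dyadic.
have h := @finite_level_prob _ _ R P (dyadic n)
  [set y | digit n y = H (dyadic n y)] (2 ^- n.+1) (2 ^ n) (@measurable_dyadic n).
rewrite (_ : [set y | digit n y = H (dyadic n y)] =
  [set y | (dyadic n y < 2 ^ n)%N] `&` [set y | digit n y = H (dyadic n y)]); last first.
  by apply/seteqP; split => y /=; [rewrite dyadic_lt|case].
rewrite h.
- by rewrite natrX exprS invfM mulrCA divff ?mulr1// gt_eqF ?exprn_gt0.
- rewrite (_ : [set y | _] =
    dyadic n.+1 @^-1` [set k | odd k = H (k %/ 2)%N]); first exact: mset.
  by apply/seteqP; split => y /=; rewrite dyadic_divS.
- move=> i ilt; rewrite -(@dyadic_prob n.+1 (2 * i + H i)%N); last first.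
    by rewrite expnS; case: (H i); lia.
  congr (P _); apply/seteqP; split => y /=.
    by move=> [<- <-]; rewrite digit_dyadic.
  move=> yE; have yi : dyadic n y = i.
    by rewrite -dyadic_divS yE; case: (H i); lia.
  by rewrite yi; split => //; rewrite /digit yE; case: (H i) => /=; lia.
Qed.

(** Given the lower digits, exactly one value of the digit of largest rank produces the parity [c],
    so [digit_prob] applies to it. *)
Lemma parity_prob (V : seq nat) (c : bool) : uniq V -> V != [::] ->
  P [set y | \big[addb/false]_(n <- V) digit n y = c] = (2^-1)%:E.
Proof.
move=> uV V0; pose N := \max_(n <- V) n.
have NV : N \in V.
  rewrite /N; elim: V {uV N} V0 => //= n V IH _; rewrite big_cons inE.
  have [->|/IH NV] := eqVneq V [::]; first by rewrite big_nil maxn0 eqxx.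
  by rewrite /maxn; case: ifP; rewrite ?NV ?eqxx ?orbT.
(* The base value [c] of the iterated sum adds the prescribed parity; the division moves the digit
   of rank [n] of an [N]-digit number to the last place. *)
pose H t := \big[addb/c]_(n <- rem N V) odd (t %/ 2 ^ (N - n.+1)).
rewrite -(digit_prob N H); congr (P _).
have VE y : \big[addb/false]_(n <- V) digit n y =
    digit N y (+) \big[addb/false]_(n <- rem N V) digit n y.
  by rewrite (perm_big _ (perm_to_rem NV)) big_cons.
have HE y : H (dyadic N y) = c (+) \big[addb/false]_(n <- rem N V) digit n y.
  rewrite /H big_seq [X in _ (+) X]big_seq.
  rewrite -[LHS]/(\big[addb/c]_(i <- rem N V | i \in rem N V) odd (dyadic N y %/ 2 ^ (N - i.+1))).
  rewrite (eq_bigr (digit ^~ y)).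
    move: (rem N V) (mem (rem N V)) => W Q.
    elim: W => [|n W IH]; first by rewrite !big_nil addbF.
    by rewrite !big_cons; case: ifP => // _; rewrite IH addbCA.
  move=> n; rewrite mem_rem_uniq// inE => /andP[nN nV].
  rewrite dyadic_div//; rewrite ltn_neqAle nN /=.
  exact: (leq_bigmax_seq (F := id)).
apply/seteqP; split => y /=; rewrite VE HE => h.
  by rewrite -h -addbA addbb addbF.
by rewrite h -addbA addbb addbF.
Qed.

End binary_digits.

(** * Products of Rademacher functions *)

Section walsh.
Context (R : realType) (Gamma : groupType).
Context (Gcount : countable [set: Gamma]).
Local Notation Omega := (bernoulli_type R Gamma).
Local Notation Q := (bernoulli_measure R Gcount).
Local Notation E f := (\int[Q]_x f x).
Implicit Types (u : Gamma * nat) (U V : {fset Gamma * nat}) (x : Omega).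

Definition rademacher u x : R := (-1) ^+ digit u.2 (sval (x u.1)).

Definition walsh U x : R := \prod_(u <- U) rademacher u x.

Lemma measurable_coordinate_event (D : set R) g : measurable D ->
  measurable [set x : Omega | D (sval (x g))].
Proof.
move=> mD; rewrite -[X in measurable X]setTI.
exact: (measurable_coordinate g measurableT mD).
Qed.

Lemma measurable_digits (H : nat -> bool) n :
  measurable [set y : R | H (dyadic n y)].
Proof.
rewrite (_ : [set y | _] = setT `&` dyadic n @^-1` [set k | H k]).
  exact: (measurable_dyadic n measurableT (Y := [set k | H k])).
by rewrite setTI.
Qed.

Lemma measurable_digit (b : bool) n : measurable [set y : R | digit n y = b].
Proof.
rewrite (_ : [set y | _] = [set y : R | (fun k => odd k == b) (dyadic n.+1 y)]).
  exact: (measurable_digits (fun k => odd k == b)).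
by apply/seteqP; split => y /= /eqP.
Qed.

Lemma measurable_parity (b : bool) (V : seq nat) :
  measurable [set y : R | \big[addb/false]_(n <- V) digit n y = b].
Proof.
elim: V b => [|n V IH] b.
  have [->|/eqP nb] := eqVneq b false.
    rewrite (_ : [set _ | _] = setT)//.
    by apply/seteqP; split => // y _ /=; rewrite big_nil.
  rewrite (_ : [set _ | _] = set0)// -subset0 => y /=.
  by rewrite big_nil => /esym.
rewrite (_ : [set _ | _] =
  ([set y | digit n y = true] `&` [set y | \big[addb/false]_(n <- V) digit n y = ~~ b]) `|`
  ([set y | digit n y = false] `&` [set y | \big[addb/false]_(n <- V) digit n y = b])).
  by apply: measurableU; apply: measurableI; rewrite //; exact: measurable_digit.
apply/seteqP; split => y /=; rewrite big_cons.
  by case: (digit n y) => /= <-; [left|right]; rewrite ?negbK.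
by move=> [] [-> ->]; rewrite //= negbK.
Qed.

Lemma sign_indic (D : Omega -> bool) x :
  (-1) ^+ D x = \1_[set z | D z = false] x - \1_[set z | D z = true] x :> R.
Proof.
rewrite !indicE.
have -> : (x \in [set z | D z = false]) = ~~ D x.
  by apply/idP/idP; rewrite inE /=; [move=> ->|move/negbTE].
have -> : (x \in [set z | D z = true]) = D x by apply/idP/idP; rewrite inE.
by case: (D x); rewrite /= ?expr1 ?expr0 ?subr0 ?sub0r.
Qed.

Lemma bounded_measurable_rademacher u : bounded_measurable (rademacher u).
Proof.
have -> : rademacher u = fun x => \1_[set z : Omega | digit u.2 (sval (z u.1)) = false] x -
    \1_[set z : Omega | digit u.2 (sval (z u.1)) = true] x.
  by apply/funext => x; exact: (sign_indic (fun z => digit u.2 (sval (z u.1)))).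
by apply: bounded_measurableB; apply: bounded_measurable_indic;
  apply: (measurable_coordinate_event (D := [set y | digit u.2 y = _]));
  exact: measurable_digit.
Qed.

Lemma bounded_measurable_walsh U : bounded_measurable (walsh U).
Proof.
by apply: bounded_measurable_prod => u; exact: bounded_measurable_rademacher.
Qed.

Lemma rademacher_sqr u x : rademacher u x * rademacher u x = 1.
Proof. by rewrite -expr2 /rademacher -exprM mulnC exprM sqrrN !expr1n. Qed.

Lemma walsh_cond U V x : (U `<=` V)%fset ->
  walsh U x = \prod_(u <- V) (if u \in U then rademacher u x else 1).
Proof.
move=> UV; rewrite /walsh big_seq.
rewrite (eq_bigr (fun u => if u \in U then rademacher u x else 1)); last by move=> u ->.
rewrite -big_seq; apply: big_fset_incl => // u _ /negbTE -> //.
Qed.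

(** Rademacher functions square to 1, so common indices cancel and the symmetric difference
    remains. *)
Lemma walshM U V x :
  walsh U x * walsh V x = walsh ((U `\` V) `|` (V `\` U))%fset x.
Proof.
rewrite (@walsh_cond U (U `|` V)%fset) ?fsubsetUl//.
rewrite (@walsh_cond V (U `|` V)%fset) ?fsubsetUr//.
rewrite (@walsh_cond _ (U `|` V)%fset); last first.
  by apply: fsetUSS; exact: fsubsetDl.
rewrite -big_split/=; apply: eq_bigr => u _.
rewrite !inE; case: (u \in U); case: (u \in V);
  by rewrite /= ?mulr1 ?mul1r ?rademacher_sqr.
Qed.

Lemma walsh0 x : walsh fset0 x = 1.
Proof. by rewrite /walsh big_seq_fset0. Qed.

(** The cylinder is there for the induction on [W]: each Rademacher factor is a difference of two
    indicators, which are absorbed into the events [B]. Without factors left, both parities at [g]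
    halve the measure of a cylinder that does not involve [g], and the signs cancel. *)
Lemma mean_parity_cylinder (g : Gamma) (V : seq nat) (s : seq Gamma)
    (B : Gamma -> set R) (W : seq (Gamma * nat)) :
  uniq V -> V != [::] -> uniq s -> g \notin s ->
  (forall u, u \in W -> u.1 \in s) -> (forall h, measurable (B h)) ->
  E (fun x => (-1) ^+ (\big[addb/false]_(n <- V) digit n (sval (x g))) *
     \1_(cylinder s B) x * \prod_(u <- W) rademacher u x) = 0.
Proof.
move=> uV V0 us gs; elim: W B => [|u W IH] B Ws mB.
  pose D b : set Omega := [set x | \big[addb/false]_(n <- V) digit n (sval (x g)) = b].
  pose B' b h := if h == g then [set y : R | \big[addb/false]_(n <- V) digit n y = b] else B h.
  have mB' b h : measurable (B' b h).
    by rewrite /B'; case: ifP => // _; exact: measurable_parity.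
  have DB b : D b `&` cylinder s B = cylinder (g :: s) (B' b).
    apply/seteqP; split => x /=.
      move=> [xD xB] h; rewrite inE /B'; case: eqP => [->//|_] /=; exact: xB.
    move=> xB; split; first by have := xB g (mem_head _ _); rewrite /B' eqxx.
    move=> h hs; have := xB h; rewrite inE hs orbT => /(_ isT).
    by rewrite /B'; case: eqP => // hg; rewrite -hg hs in gs.
  have QD b : Q (D b `&` cylinder s B) =
      (2^-1 * \prod_(h <- s) fine (lebesgue_measure (B h `&` `[0, 1]%classic)))%:E.
    rewrite DB bernoulli_measureP//=; last by rewrite gs.
    rewrite big_cons {1}/B' eqxx -uniform01E; last exact: measurable_parity.
    rewrite parity_prob//=; congr (_ * _)%:E.
    rewrite !big_seq; apply: eq_bigr => h hs; rewrite /B'.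
    by case: eqP => // hg; rewrite -hg hs in gs.
  have mD b : measurable (D b).
    exact: (measurable_coordinate_event g (measurable_parity b V)).
  have mc : measurable (cylinder s B) by exact: measurable_cylinder.
  have mDc b : measurable (D b `&` cylinder s B) by exact: measurableI.
  have bDc b := bounded_measurable_indic R (mDc b).
  transitivity (E (fun x => \1_(D false `&` cylinder s B) x - \1_(D true `&` cylinder s B) x)).
    apply: eq_Rintegral => x _; rewrite big_nil mulr1 !indicI.
    rewrite (sign_indic (fun z : Omega => \big[addb/false]_(n <- V) digit n (sval (z g)))).
    by rewrite mulrBl.
  by rewrite meanB// !mean_indic// [Q _]QD [Q _]QD subrr.
pose B' b h := if h == u.1 then B h `&` [set y : R | digit u.2 y = b] else B h.
have mB' b h : measurable (B' b h).
  by rewrite /B'; case: ifP => // _; apply: measurableI => //; exact: measurable_digit.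
have us1 : u.1 \in s by apply: Ws; rewrite mem_head.
have DB b x : \1_(cylinder s (B' b)) x =
    \1_(cylinder s B) x * \1_[set z : Omega | digit u.2 (sval (z u.1)) = b] x :> R.
  rewrite -[RHS]/((\1_(cylinder s B) \* \1_[set z : Omega | digit u.2 (sval (z u.1)) = b]) x).
  rewrite -indicI; congr (\1_ _ x); apply/seteqP; split => z /=.
    move=> zB; split.
      by move=> h hs; have := zB h hs; rewrite /B'; case: eqP => // _ [].
    by have := zB _ us1; rewrite /B' eqxx => -[].
  by move=> [zB zu] h hs; rewrite /B'; case: eqP => [->|_]; [split => //; exact: zB|exact: zB].
have mc b : measurable (cylinder s (B' b)) by exact: measurable_cylinder.
have bc b := bounded_measurable_indic R (mc b).
have br := bounded_measurable_rademacher.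
have bpar : bounded_measurable (fun x : Omega =>
    (-1) ^+ (\big[addb/false]_(n <- V) digit n (sval (x g))) : R).
  have -> : (fun x : Omega => (-1) ^+ (\big[addb/false]_(n <- V) digit n (sval (x g))) : R) =
      (fun x => \1_[set z : Omega | \big[addb/false]_(n <- V) digit n (sval (z g)) = false] x -
    \1_[set z : Omega | \big[addb/false]_(n <- V) digit n (sval (z g)) = true] x).
    apply/funext => x.
    exact: (sign_indic (fun z : Omega => \big[addb/false]_(n <- V) digit n (sval (z g)))).
  by apply: bounded_measurableB; apply: bounded_measurable_indic;
    exact: (measurable_coordinate_event g (measurable_parity _ V)).
transitivity (E (fun x =>
  (-1) ^+ (\big[addb/false]_(n <- V) digit n (sval (x g))) *
     \1_(cylinder s (B' false)) x * (\prod_(u <- W) rademacher u x) -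
  (-1) ^+ (\big[addb/false]_(n <- V) digit n (sval (x g))) *
     \1_(cylinder s (B' true)) x * (\prod_(u <- W) rademacher u x))).
  apply: eq_Rintegral => x _; rewrite big_cons !DB.
  rewrite {1}/rademacher (sign_indic (fun z : Omega => digit u.2 (sval (z u.1)))).
  by ring.
rewrite meanB; try bounded.
by rewrite !IH ?subrr// => w wW; apply: Ws; rewrite inE wW orbT.
Qed.

(** The factors at the coordinate of one index of [U] form the sign of a parity of digits, and the
    other factors depend on the coordinates in [s]; the cylinder starts as the whole space. *)
Lemma mean_walsh U : U != fset0 -> E (walsh U) = 0.
Proof.
move=> /fset0Pn[u0 u0U]; set g := u0.1.
pose V := [seq u.2 | u <- U & u.1 == g].
pose W := [seq u <- U | u.1 != g].
have uV : uniq V.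
  rewrite map_inj_in_uniq ?filter_uniq ?fset_uniq// => -[a n] [b m].
  by rewrite !mem_filter /= => /andP[/eqP-> _] /andP[/eqP-> _] ->.
have V0 : V != [::].
  have h : u0.2 \in V by apply/mapP; exists u0 => //; rewrite mem_filter eqxx.
  by apply/eqP => V0; rewrite V0 in h.
pose s := undup [seq u.1 | u <- W].
transitivity (E (fun x => (-1) ^+ (\big[addb/false]_(n <- V) digit n (sval (x g))) *
     \1_(cylinder s (fun=> setT)) x * \prod_(u <- W) rademacher u x)).
  apply: eq_Rintegral => x _; rewrite /walsh (bigID (fun u => u.1 == g))/=.
  rewrite -[X in X * _]big_filter -[X in _ * X]big_filter; congr (_ * _).
  rewrite indicE mem_set// mulr1 /V big_map.
  rewrite (@big_morph _ _ (fun b : bool => (-1) ^+ b : R) 1 *%R false addb)//; last first.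
    by move=> b c; rewrite signr_addb.
  by apply: eq_big_seq => u; rewrite mem_filter => /andP[/eqP ug _]; rewrite -ug.
apply: mean_parity_cylinder => //.
- exact: undup_uniq.
- by rewrite mem_undup; apply/mapP => -[u]; rewrite mem_filter => /andP[/eqP h _] /esym.
- by move=> u uW; rewrite mem_undup map_f.
Qed.

End walsh.

(** * Finite Walsh expansions *)

Section walsh_polynomials.
Context (R : realType) (Gamma : groupType).
Context (Gcount : countable [set: Gamma]).
Local Notation Omega := (bernoulli_type R Gamma).
Local Notation Q := (bernoulli_measure R Gcount).
Local Notation E f := (\int[Q]_x f x).
Implicit Types (u : Gamma * nat) (U V : {fset Gamma * nat}) (x : Omega).
Implicit Types (f : Omega -> R) (W : seq {fset Gamma * nat}).

Let bw U : bounded_measurable (walsh U : Omega -> R).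
Proof. exact: bounded_measurable_walsh. Qed.

Lemma mean_walshM U V : E (fun x => walsh U x * walsh V x) = (U == V)%:R.
Proof.
under eq_Rintegral do rewrite walshM.
have [->|UV] := eqVneq U V.
  rewrite fsetDv fset0U; under eq_Rintegral do rewrite walsh0.
  exact: mean_cst.
apply: mean_walsh; apply: contra UV; rewrite fsetU_eq0 !fsetD_eq0 => /andP[h1 h2].
by rewrite eqEfsubset h1.
Qed.

Definition walsh_coef f U : R := E (fun x => f x * walsh U x).

Definition walsh_poly f : Prop := exists s : seq (R * {fset Gamma * nat}),
  forall x, f x = \sum_(p <- s) p.1 * walsh p.2 x.

Lemma walsh_poly_bounded f : walsh_poly f -> bounded_measurable f.
Proof.
move=> [s fE]; have -> : f = fun x => \sum_(p <- s) p.1 * walsh p.2 x by apply/funext.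
by bounded; exact: bw.
Qed.

(** Any larger list [W] is allowed so that several functions can be expanded over a common one. *)
Lemma walsh_poly_support f : walsh_poly f -> exists W0, forall W, uniq W ->
  {subset W0 <= W} ->
  (forall x, f x = \sum_(U <- W) walsh_coef f U * walsh U x) /\
  (forall U, U \notin W -> walsh_coef f U = 0).
Proof.
move=> [s fE]; exists [seq p.2 | p <- s] => W uW sW.
have coefE U : walsh_coef f U = \sum_(p <- s) p.1 * (p.2 == U)%:R.
  transitivity (E (fun x => \sum_(p <- s) p.1 * (walsh p.2 x * walsh U x))).
    by apply: eq_Rintegral => x _; rewrite fE big_distrl/=; under eq_bigr do rewrite -mulrA.
  rewrite mean_sum; last by move=> p; bounded; exact: bw.
  apply: eq_bigr => p _; rewrite meanZ ?mean_walshM//.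
  by apply: bounded_measurableM; exact: bw.
split => [x|U UW]; last first.
  rewrite coefE big_seq big1// => p ps; case: eqP => [pU|]; last by rewrite mulr0.
  by rewrite -pU (sW p.2) ?map_f in UW.
rewrite fE; under [RHS]eq_bigr do rewrite coefE big_distrl/=.
rewrite exchange_big/= big_seq [RHS]big_seq; apply: eq_bigr => p ps.
rewrite (big_rem p.2) ?sW ?map_f//= eqxx mulr1 big_seq big1 ?addr0// => U.
by rewrite mem_rem_uniq// inE => /andP[/negbTE Up _]; rewrite eq_sym Up mulr0 mul0r.
Qed.

(** Pairing [f] with its own expansion gives each coefficient times itself; orthogonality has
    already been used to obtain the expansion. *)
Lemma parseval f W : bounded_measurable f ->
  (forall x, f x = \sum_(U <- W) walsh_coef f U * walsh U x) ->
  E (fun x => f x ^+ 2) = \sum_(U <- W) walsh_coef f U ^+ 2.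
Proof.
move=> bf fE.
transitivity (E (fun x => \sum_(U <- W) walsh_coef f U * (f x * walsh U x))).
  apply: eq_Rintegral => x _; rewrite expr2 {2}fE big_distrr/=.
  by apply: eq_bigr => U _; rewrite mulrCA.
rewrite mean_sum; last by move=> U; bounded; exact: bw.
apply: eq_bigr => U _; rewrite meanZ//.
by apply: bounded_measurableM => //; exact: bw.
Qed.

Lemma walsh_poly_cst c : walsh_poly (fun=> c).
Proof.
by exists [:: (c, fset0)] => x; rewrite big_seq1 walsh0 mulr1.
Qed.

Lemma walsh_polyD f h : walsh_poly f -> walsh_poly h -> walsh_poly (fun x => f x + h x).
Proof.
by move=> [s fE] [t hE]; exists (s ++ t) => x; rewrite big_cat fE hE.
Qed.

Lemma walsh_polyM f h : walsh_poly f -> walsh_poly h -> walsh_poly (fun x => f x * h x).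
Proof.
move=> [s fE] [t hE].
exists [seq (p.1 * q.1, ((p.2 `\` q.2) `|` (q.2 `\` p.2))%fset) | p <- s, q <- t] => x.
rewrite big_allpairs_dep fE hE big_distrl/=; apply: eq_bigr => p _.
by rewrite big_distrr/=; apply: eq_bigr => q _; rewrite -walshM mulrACA.
Qed.

Lemma walsh_polyB f h : walsh_poly f -> walsh_poly h -> walsh_poly (fun x => f x - h x).
Proof.
move=> pf ph; have := walsh_polyD pf (walsh_polyM (walsh_poly_cst (-1)) ph).
by congr walsh_poly; apply/funext => x; rewrite mulN1r.
Qed.

Lemma walsh_poly_rademacher u : walsh_poly (rademacher u).
Proof.
by exists [:: (1, [fset u]%fset)] => x; rewrite big_seq1 mul1r /walsh big_seq_fset1.
Qed.

(** Induction on the last digit: a function of a sign is its half-sum plus the sign times its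
    half-difference. *)
Lemma walsh_poly_dyadic g n (H : nat -> R) :
  walsh_poly (fun x => H (dyadic n (sval (x g)))).
Proof.
elim: n H => [|n IH] H.
  rewrite (_ : (fun x : Omega => _) = (fun=> H 0%N)); first exact: walsh_poly_cst.
  apply/funext => x.
  by have := dyadic_lt 0 (sval (x g)); case: (dyadic _ _).
have pr := walsh_poly_rademacher (g, n).
have := walsh_polyD
  (walsh_polyM (IH (fun k => (H (2 * k)%N + H (2 * k).+1) / 2)) (walsh_poly_cst 1))
  (walsh_polyM (IH (fun k => (H (2 * k)%N - H (2 * k).+1) / 2)) pr).
congr walsh_poly; apply/funext => x.
rewrite /rademacher digit_dyadic mulr1 /=; set k := dyadic _ _.
by case: (digit _ _); rewrite ?addn1 ?addn0 ?expr1 ?expr0; field.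
Qed.

Definition translate (g : Gamma) U : {fset Gamma * nat} :=
  [fset ((g * u.1)%g, u.2) | u in U]%fset.

Lemma translate_inj g : injective (fun u : Gamma * nat => ((g * u.1)%g, u.2)).
Proof. by move=> [a n] [b m] /= [/mulgI -> ->]. Qed.

Lemma translateK g : cancel (translate g) (translate g^-1%g).
Proof.
move=> U; apply/fsetP => -[a n]; apply/imfsetP/idP => /=.
  by move=> [_ /imfsetP[/= [b m] bU ->] /= [-> ->]]; rewrite mulgA mulVg mul1g.
move=> aU; exists ((g * a)%g, n); last by rewrite /= mulgA mulVg mul1g.
by apply/imfsetP; exists (a, n).
Qed.

Local Notation shift := (act (bernoulli_shift R Gcount)).

Lemma walsh_shift g U x : walsh U (shift g x) = walsh (translate g^-1%g U) x.
Proof.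
rewrite /walsh /translate big_imfset//=; first by move=> u v _ _; exact: translate_inj.
Qed.

Lemma walsh_poly_shift g f : walsh_poly f -> walsh_poly (fun x => f (shift g x)).
Proof.
move=> [s fE]; exists [seq (p.1, translate g^-1%g p.2) | p <- s] => x.
by rewrite big_map fE; apply: eq_bigr => p _; rewrite walsh_shift.
Qed.

Lemma walsh_coef_shift g f U : bounded_measurable f ->
  walsh_coef f (translate g U) = walsh_coef (fun x => f (shift g x)) U.
Proof.
move=> bf; rewrite /walsh_coef.
rewrite -(mean_act (c := bernoulli_shift R Gcount) g
  (f := fun x => f x * walsh (translate g U) x)); last first.
  by apply: bounded_measurableM => //; exact: bw.
by apply: eq_Rintegral => x _; rewrite walsh_shift translateK.
Qed.

Lemma walsh_coef0 f : walsh_coef f fset0 = E f.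
Proof. by apply: eq_Rintegral => x _; rewrite walsh0 mulr1. Qed.

Lemma walsh_coefB f h U : bounded_measurable f -> bounded_measurable h ->
  walsh_coef (fun x => f x - h x) U = walsh_coef f U - walsh_coef h U.
Proof.
move=> bf bh; rewrite /walsh_coef -meanB; try by bounded; exact: bw.
by apply: eq_Rintegral => x _; rewrite mulrBl.
Qed.

End walsh_polynomials.

(** * Approximation of events by Walsh polynomials *)

Section density.
Context (R : realType) (Gamma : groupType).
Context (Gcount : countable [set: Gamma]).
Local Notation Omega := (bernoulli_type R Gamma).
Local Notation Q := (bernoulli_measure R Gcount).
Local Notation E f := (\int[Q]_x f x).
Implicit Types (A B : set Omega) (x : Omega).

(** The approximant must again be an indicator: this is stable under Boolean operations, and later
    the mean of its square is its mean. *)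
Definition walsh_approximable A : Prop := measurable A /\
  forall e : R, 0 < e -> exists2 B, walsh_poly (\1_B : Omega -> R) &
    E (fun x => `|\1_A x - \1_B x : R|) <= e.

Lemma walsh_approximable_poly A : measurable A -> walsh_poly (\1_A : Omega -> R) ->
  walsh_approximable A.
Proof.
move=> mA pA; split => // e e0; exists A => //.
under eq_Rintegral do rewrite subrr normr0.
by rewrite mean_cst ltW.
Qed.

Lemma indicC_sub A x : \1_(~` A) x = 1 - \1_A x :> R.
Proof. by rewrite !indicE in_setC; case: (x \in A); rewrite /= ?subrr ?subr0. Qed.

Lemma walsh_approximableC A : walsh_approximable A -> walsh_approximable (~` A).
Proof.
move=> [mA h]; split; first exact: measurableC.
move=> e e0; have [B pB AB] := h e e0; exists (~` B).
  rewrite (_ : \1__ = fun x => 1 - \1_B x); last by apply/funext => x; exact: indicC_sub.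
  by apply: walsh_polyB => //; exact: walsh_poly_cst.
apply: le_trans AB; rewrite le_eqVlt; apply/orP; left; apply/eqP.
by apply: eq_Rintegral => x _; rewrite !indicC_sub distrC; congr (`|_|); ring.
Qed.

Lemma walsh_approximableI A A' : walsh_approximable A -> walsh_approximable A' ->
  walsh_approximable (A `&` A').
Proof.
move=> [mA hA] [mA' hA']; split; first exact: measurableI.
move=> e e0; have e20 : 0 < e / 2 by rewrite divr_gt0.
have [B pB AB] := hA _ e20; have [B' pB' AB'] := hA' _ e20; exists (B `&` B').
  by rewrite indicI; exact: walsh_polyM.
have bA := bounded_measurable_indic R mA.
have bA' := bounded_measurable_indic R mA'.
have bB := walsh_poly_bounded pB; have bB' := walsh_poly_bounded pB'.
have bAI := bounded_measurable_indic R (measurableI _ _ mA mA').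
have bBI := walsh_poly_bounded (walsh_polyM pB pB').
rewrite !indicI.
apply: (@le_trans _ _ (E (fun x => `|\1_A x - \1_B x : R| + `|\1_A' x - \1_B' x : R|))).
  apply: le_mean; try bounded.
  move=> x /=; rewrite !indicE.
  by case: (x \in A); case: (x \in B); case: (x \in A'); case: (x \in B');
    rewrite /= ?mulr1 ?mulr0 ?subrr ?subr0 ?sub0r ?normrN ?normr1 ?normr0; lra.
by rewrite meanD; try bounded; lra.
Qed.

Lemma walsh_approximableU A A' : walsh_approximable A -> walsh_approximable A' ->
  walsh_approximable (A `|` A').
Proof.
move=> hA hA'; rewrite -[_ `|` _]setCK setCU.
by apply/walsh_approximableC/walsh_approximableI; exact: walsh_approximableC.
Qed.

Lemma walsh_approximable_bigcup (F : nat -> set Omega) :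
  (forall n, walsh_approximable (F n)) -> walsh_approximable (\bigcup_n F n).
Proof.
move=> hF.
have mF n : measurable (F n) by case: (hF n).
have mU : measurable (\bigcup_n F n) by exact: bigcup_measurable.
pose G n := \big[setU/set0]_(i < n.+1) F i.
have hG n : walsh_approximable (G n).
  rewrite /G; move: n.+1 => {}n; elim: n => [|n IH];
    last by rewrite big_ord_recr; exact: walsh_approximableU.
  rewrite big_ord0; apply: walsh_approximable_poly => //.
  by rewrite indic0; exact: walsh_poly_cst.
have mG n : measurable (G n) by case: (hG n).
split => // e e0; have e20 : 0 < e / 2 by rewrite divr_gt0.
(* Continuity from below reduces the countable union to a finite one, which Boolean operations
   handle. *)
have [n nE] : exists n, E (fun x => `|\1_(\bigcup_n F n) x - \1_(G n) x : R|) <= e / 2.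
  have UE : \bigcup_n G n = \bigcup_n F n by exact: bigcup_bigsetU_bigcup.
  have : (Q \o G) @ \oo --> Q (\bigcup_n G n).
    apply: nondecreasing_cvg_mu => //; first by rewrite UE.
    by move=> m n mn; apply/subsetPset; exact: subset_bigsetU.
  rewrite UE -(@fineK _ (Q (\bigcup_n F n))) ?fin_num_measure//.
  move=> /fine_cvgP[_ /cvgrPdist_lt/(_ _ e20)[n _ /(_ n (leqnn n)) /=]] h.
  exists n; apply: le_trans (ltW h).
  have GU : G n `<=` \bigcup_n F n by rewrite -UE => x Gx; exists n.
  rewrite -!mean_indic// -meanB; try exact: bounded_measurable_indic.
  apply: le_trans (ler_norm _); rewrite le_eqVlt; apply/orP; left; apply/eqP.
  apply: eq_Rintegral => x _; rewrite ger0_norm// subr_ge0 !indicE ler_nat.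
  case: (boolP (x \in G n)) => //; rewrite inE => /GU xU.
  by rewrite mem_set.
have [_ /(_ _ e20)[B pB GB]] := hG n; exists B => //.
have bU := bounded_measurable_indic R mU; have bG := bounded_measurable_indic R (mG n).
have bB := walsh_poly_bounded pB.
apply: (@le_trans _ _ (E (fun x => `|\1_(\bigcup_n F n) x - \1_(G n) x : R| +
    `|\1_(G n) x - \1_B x : R|))).
  by apply: le_mean; try bounded; move=> x; exact: ler_distD.
by rewrite meanD; try bounded; lra.
Qed.

(** The dyadic approximations from below converge to the coordinate, so the strict inequality is
    already seen at a finite order. *)
Lemma walsh_approximable_ray g (c : R) :
  walsh_approximable [set x : Omega | c < sval (x g)].
Proof.
have -> : [set x : Omega | c < sval (x g)] =
    \bigcup_n [set x : Omega | c < (dyadic n (sval (x g)))%:R / 2 ^+ n].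
  apply/seteqP; split => x /=; last first.
    move=> [n _ /= /lt_le_trans]; apply.
    by have /andP[] := dyadic_bounds n (svalP (x g)).
  rewrite -subr_gt0 => cx; have [n nc] := half_power_lt cx; exists n => //=.
  have /andP[_] := dyadic_bounds n (svalP (x g)).
  rewrite -natr1 mulrDl mul1r; lra.
apply: walsh_approximable_bigcup => n; apply: walsh_approximable_poly.
  apply: (measurable_coordinate_event g (D := [set y | c < (dyadic n y)%:R / 2 ^+ n])).
  exact: (measurable_digits (fun k => c < k%:R / 2 ^+ n)).
have := @walsh_poly_dyadic R Gamma g n (fun k => (c < k%:R / 2 ^+ n)%R%:R).
by congr walsh_poly; apply/funext => x; rewrite indic_bool.
Qed.

Lemma walsh_approximable_measurable A : measurable A -> walsh_approximable A.
Proof.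
suff salg : sigma_algebra setT walsh_approximable.
  apply: smallest_sub => //.
  move=> _ [g [D [mD ->]]].
  suff : <<s RGenOInfty.G (R := R) >> `<=`
      [set D | walsh_approximable [set x : Omega | D (sval (x g))]].
    apply; rewrite -[X in X D](RGenOInfty.measurableE R); exact: mD.
  apply: smallest_sub.
    have [s0 sC sU] := salg; split => /=.
    - exact: s0.
    - by move=> D' /sC.
    - by move=> F hF; exact: sU hF.
  move=> _ [c ->]; have := walsh_approximable_ray g c.
  by congr walsh_approximable; apply/seteqP; split => x /=; rewrite in_itv /= andbT.
split.
- apply: walsh_approximable_poly => //; rewrite indic0; exact: walsh_poly_cst.
- by move=> A' hA; rewrite setTD; exact: walsh_approximableC.
- exact: walsh_approximable_bigcup.
Qed.

End density.

(** * The Bernoulli shift *)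

Section bernoulli_strongly_ergodic.
Context (R : realType) (Gamma : groupType).
Context (Gcount : countable [set: Gamma]).
Local Notation Omega := (bernoulli_type R Gamma).
Local Notation Q := (bernoulli_measure R Gcount).
Local Notation E f := (\int[Q]_x f x).
Local Notation shift := (act (bernoulli_shift R Gcount)).
Implicit Types (U V : {fset Gamma * nat}) (S : set Gamma) (f : Omega -> R).

(* The division by [0] makes this vanish when [U] is empty. *)
Definition fraction S U : R := (\sum_(u <- U) \1_S u.1) / #|` U|%:R.

Lemma fraction_ge0 S U : 0 <= fraction S U.
Proof. by rewrite divr_ge0// sumr_ge0. Qed.

Lemma fraction_setT U : fraction setT U = (U != fset0)%:R.
Proof.
rewrite /fraction (eq_bigr (fun=> 1)); last by move=> u _; rewrite indicT.
rewrite big_const_seq count_predT iter_addr_0.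
have [->|U0] := eqVneq U fset0; first by rewrite cardfs0 mul0r.
by rewrite divff// pnatr_eq0 cardfs_eq0.
Qed.

Lemma fractionD S S' U : S `&` S' = set0 ->
  fraction (S `|` S') U = fraction S U + fraction S' U.
Proof.
move=> SS; rewrite /fraction -mulrDl -big_split/=; congr (_ / _).
apply: eq_bigr => u _; rewrite !indicE in_setU.
case: (boolP (_ \in S)) => uS; case: (boolP (_ \in S')) => uS'; rewrite /= ?addr0 ?add0r//.
move: uS uS'; rewrite !inE => uS uS'.
by have : set0 u.1 by rewrite -SS.
Qed.

Lemma fraction_le1 S U : fraction S U <= 1.
Proof.
have : fraction (S `|` ~` S) U <= 1.
  by rewrite setUv fraction_setT; case: (_ != _).
by rewrite fractionD ?setICr//; have := fraction_ge0 (~` S) U; lra.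
Qed.

Lemma fraction_translate g S U :
  fraction [set (g * h)%g | h in S] (translate g U) = fraction S U.
Proof.
rewrite /fraction /translate card_imfset; last exact: translate_inj.
rewrite big_imfset/=; last by move=> u v _ _; exact: translate_inj.
congr (_ / _); apply: eq_bigr => u _; rewrite !indicE; congr (nat_of_bool _)%:R.
apply/idP/idP; rewrite !inE; last by exists u.1.
by move=> [h hS /mulgI <-].
Qed.

(** Weighted arithmetic-geometric inequality for |a - b| |a + b|. Summed over all indices with a
    fixed [t], it plays the role of the Cauchy-Schwarz inequality. *)
Lemma sqr_dist_le (a b t : R) : 0 < t ->
  `|a ^+ 2 - b ^+ 2| <= (a - b) ^+ 2 / (2 * t) + t * (a ^+ 2 + b ^+ 2).
Proof.
move=> t0; have t20 : 0 < 2 * t by rewrite mulr_gt0.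
rewrite -(ler_pM2r t20) [leRHS]mulrDl divfK ?gt_eqF//.
have h1 : 0 <= (a - b - t * (a + b)) ^+ 2 by exact: sqr_ge0.
have h2 : 0 <= (a - b + t * (a + b)) ^+ 2 by exact: sqr_ge0.
have h3 : 0 <= (t * (a - b)) ^+ 2 by exact: sqr_ge0.
by case: (ler0P (a ^+ 2 - b ^+ 2)) => _; lra.
Qed.

(* The squares of the Walsh coefficients define a measure on the finite
   subsets of [Gamma * nat], which depends on [f] in an equivariant and
   uniformly continuous way; every nonempty set is replaced with the uniform
   measure on its points. *)
Lemma walsh_mean f : walsh_poly f -> exists m : set Gamma -> R,
  [/\ forall S, 0 <= m S,
      m setT = E (fun x => f x ^+ 2) - E f ^+ 2,
      forall S S', S `&` S' = set0 -> m (S `|` S') = m S + m S' &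
      forall g S t, 0 < t -> `|m [set (g * h)%g | h in S] - m S| <=
        E (fun x => (f (shift g x) - f x) ^+ 2) / (2 * t)
        + t * (2 * E (fun x => f x ^+ 2))].
Proof.
move=> pf; have bf := walsh_poly_bounded pf.
have [W0 W0P] := walsh_poly_support Gcount pf.
pose c U := walsh_coef Gcount f U ^+ 2.
pose m S := \sum_(U <- undup W0) c U * fraction S U.
have [_ c0] := W0P (undup W0) (undup_uniq _) ltac:(by move=> U; rewrite mem_undup).
have widen W (F : {fset Gamma * nat} -> R) : uniq W -> {subset W0 <= W} ->
    \sum_(U <- undup W0) c U * F U = \sum_(U <- W) c U * F U.
  move=> uW sW; rewrite [RHS](bigID (mem (undup W0)))/= [X in _ = _ + X]big1 ?addr0.
    rewrite -[RHS]big_filter; apply/perm_big/uniq_perm.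
    - exact: undup_uniq.
    - exact: filter_uniq.
    by move=> U; rewrite mem_filter/= mem_undup andb_idr// => /sW.
  by move=> U /c0; rewrite /c => ->; rewrite expr0n mul0r.
have c_sum W : uniq W -> {subset W0 <= W} -> \sum_(U <- W) c U = E (fun x => f x ^+ 2).
  by move=> uW sW; rewrite (parseval bf (W0P W uW sW).1).
exists m; split.
- by move=> S; apply: sumr_ge0 => U _; rewrite mulr_ge0 ?sqr_ge0 ?fraction_ge0.
(* The empty set is added to the list: its squared coefficient is E f ^+ 2 and its [fraction] is 0,
   so dropping it from Parseval's sum leaves the variance. *)
- have [W [uW sW h0]] : exists W, [/\ uniq W, {subset W0 <= W} & fset0 \in W].
    exists (undup (fset0 :: W0)); split; first exact: undup_uniq.
      by move=> U; rewrite mem_undup inE orbC => ->.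
    by rewrite mem_undup mem_head.
  rewrite -(c_sum W)// /m (widen W)// -walsh_coef0.
  rewrite (big_rem _ h0) [X in _ = X - _](big_rem _ h0)/=.
  rewrite fraction_setT eqxx mulr0 add0r /c addrAC subrr add0r.
  apply: eq_big_seq => U; rewrite mem_rem_uniq// inE => /andP[U0 _].
  by rewrite fraction_setT U0 mulr1.
- move=> S S' SS; rewrite /m -big_split/=; apply: eq_bigr => U _.
  by rewrite fractionD// mulrDr.
- move=> g S t t0.
  have pg := walsh_poly_shift Gcount g pf; have bg := walsh_poly_bounded pg.
  have pd := walsh_polyB pg pf; have bd := walsh_poly_bounded pd.
  have [W1 W1P] := walsh_poly_support Gcount pg.
  have [W2 W2P] := walsh_poly_support Gcount pd.
  (* [W] supports [f], its translate and their difference, and its translate by [g] contains [W0],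
     so that all sums below run over one list. *)
  pose W := undup (W0 ++ W1 ++ W2 ++ [seq translate g^-1%g U | U <- W0]).
  have uW : uniq W by exact: undup_uniq.
  have sW0 : {subset W0 <= W} by move=> U; rewrite mem_undup !mem_cat => ->.
  have sW1 : {subset W1 <= W} by move=> U; rewrite mem_undup !mem_cat => ->; rewrite !orbT.
  have sW2 : {subset W2 <= W} by move=> U; rewrite mem_undup !mem_cat => ->; rewrite !orbT.
  have sWg : {subset W0 <= [seq translate g U | U <- W]}.
    move=> U UW; apply/mapP; exists (translate g^-1%g U).
      by rewrite mem_undup !mem_cat map_f ?orbT.
    by rewrite -{1}[g]invgK translateK.
  have uWg : uniq [seq translate g U | U <- W].
    by rewrite map_inj_uniq//; exact: can_inj (@translateK _ g).
  pose cg U := walsh_coef Gcount (fun x => f (shift g x)) U ^+ 2.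
  (* Reindexing by the translation moves [g] from the set onto the function, so only squared
     coefficients remain to be compared. *)
  have -> : m [set (g * h)%g | h in S] = \sum_(U <- W) cg U * fraction S U.
    rewrite /m (widen _ _ uWg sWg) big_map; apply: eq_bigr => U _.
    by rewrite fraction_translate /c walsh_coef_shift.
  rewrite /m (widen _ _ uW sW0) -sumrB.
  apply: le_trans (ler_norm_sum _ _ _) _.
  apply: (@le_trans _ _ (\sum_(U <- W)
     ((walsh_coef Gcount (fun x => f (shift g x) - f x) U) ^+ 2 / (2 * t) +
       t * (cg U + c U)))).
    apply: ler_sum => U _; rewrite -mulrBl normrM (ger0_norm (fraction_ge0 _ _)).
    apply: (@le_trans _ _ `|cg U - c U|).
      by rewrite ler_piMr// fraction_le1.
    by rewrite walsh_coefB//; exact: sqr_dist_le.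
  rewrite big_split/= -big_distrl/= -big_distrr/= big_split/=.
  rewrite (c_sum W)// -(parseval bd (W2P W uW sW2).1).
  rewrite -(parseval bg (W1P W uW sW1).1).
  rewrite (mean_act (c := bernoulli_shift R Gcount) g (f := fun x => f x ^+ 2)).
    by rewrite le_eqVlt; apply/orP; left; apply/eqP; ring.
  exact: (bounded_measurableX 2 bf).
Qed.

End bernoulli_strongly_ergodic.

Lemma indic_itv (T : Type) (R : numDomainType) (A : set T) x :
  0 <= (\1_A x : R) <= 1.
Proof. by rewrite indicE; case: (_ \in _); rewrite /= lexx ler01. Qed.

Lemma mean_indic_itv d (T : measurableType d) (R : realType)
    (P : probability T R) (A : set T) : bounded_measurable (\1_A : T -> R) ->
  0 <= \int[P]_x (\1_A x : R) <= 1.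
Proof.
move=> bA; apply/andP; split.
  by apply: mean_ge0 => x; have /andP[] := indic_itv R A x.
rewrite -[leRHS](mean_cst P 1); by apply: le_mean => //; bounded.
Qed.

(** * Strong ergodicity and freeness *)

Section bernoulli_properties.
Context (R : realType) (Gamma : groupType).
Context (Gcount : countable [set: Gamma]).
Local Notation Omega := (bernoulli_type R Gamma).
Local Notation Q := (bernoulli_measure R Gcount).
Local Notation E f := (\int[Q]_x f x).
Local Notation s_Gamma := (bernoulli_shift R Gcount).

(** The means differ by at most the L1 distance, and p (1 - p) is 1-Lipschitz on [0, 1]. *)
Lemma variance_indic_dist (A B : set Omega) (e : R) :
  bounded_measurable (\1_A : Omega -> R) -> bounded_measurable (\1_B : Omega -> R) ->
  E (fun x => `|\1_A x - \1_B x : R|) <= e ->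
  E \1_A * (1 - E \1_A) - e <= E \1_B * (1 - E \1_B).
Proof.
move=> bA bB; have : `|E \1_A - E \1_B| <= E (fun x => `|\1_A x - \1_B x : R|).
  rewrite -meanB//; apply: le_normr_Rintegral => //.
  by apply: bounded_integrable; bounded.
move=> h /(le_trans h); rewrite ler_norml.
have /andP[] := mean_indic_itv Q bA; have /andP[] := mean_indic_itv Q bB.
move: (E \1_A) (E \1_B) => p q q0 q1 p0 p1 /andP[h1 h2].
have [pq|pq] := lerP p q.
  have : 0 <= (q - p) * (2 - p - q) by apply: mulr_ge0; lra.
  by nra.
have : 0 <= (p - q) * (p + q) by apply: mulr_ge0; lra.
by nra.
Qed.

Theorem bernoulli_strongly_ergodic : ~ amenable R Gamma -> strongly_ergodic s_Gamma.
Proof.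
move=> nonam A mA Ainv.
have bA n : bounded_measurable (\1_(A n) : Omega -> R) by exact: bounded_measurable_indic.
have {}Ainv g r : 0 < r -> exists N, forall n, (N <= n)%N ->
    E (fun x => `|\1_(A n) (act s_Gamma g x) - \1_(A n) x : R|) < r.
  move=> r0; have := Ainv g^-1%g.
  rewrite (_ : (fun n => _) = (fun n =>
      (E (fun x => `|\1_(A n) (act s_Gamma g x) - \1_(A n) x : R|))%:E)).
    move=> /ecvg0P/(_ r r0)[N NP]; exists N => n Nn.
    exact: le_lt_trans (ler_norm _) (NP n Nn).
  by apply/funext => n; rewrite prob_displacement// invgK.
rewrite (_ : (fun n => _) = (fun n => (E \1_(A n) * (1 - E \1_(A n)))%:E)); last first.
  by apply/funext => n; rewrite mean_indic// EFinM EFinB fineK// fin_num_measure.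
apply/ecvg0P; apply: contrapT => /existsNP[r /not_implyP[r0 /forallNP nr]].
apply: nonam.
have /choice[k kP] : forall N, exists n, (N <= n)%N /\ r <= E \1_(A n) * (1 - E \1_(A n)).
  move=> N; have /existsNP[n /not_implyP[Nn /negP]] := nr N.
  rewrite -leNgt ger0_norm; first by exists n.
  by have /andP[h0 h1] := mean_indic_itv Q (bA n); rewrite mulr_ge0// subr_ge0.
(* The precision is at most r / 2, which keeps the variance above r / 2, and tends to 0, which keeps
   the sequence asymptotically invariant. *)
have /choice[B BP] : forall n, exists B : set Omega, walsh_poly (\1_B : Omega -> R) /\
    E (fun x => `|\1_(A (k n)) x - \1_B x : R|) <= r / 2 * 2 ^- n.
  move=> n; have [_ h] := walsh_approximable_measurable Gcount (mA (k n)).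
  have [|B ? ?] := h (r / 2 * 2 ^- n); last by exists B.
  by rewrite mulr_gt0 ?divr_gt0// invr_gt0 exprn_gt0.
have bB n : bounded_measurable (\1_(B n) : Omega -> R) := walsh_poly_bounded (BP n).1.
have bBg n g := bounded_measurable_act (c := s_Gamma) g (bB n).
have bAg n g := bounded_measurable_act (c := s_Gamma) g (bA n).
have /choice[m mP] := fun n => walsh_mean Gcount (BP n).1.
have sqB n : E (fun x => \1_(B n) x ^+ 2 : R) = E \1_(B n).
  by apply: eq_Rintegral => x _; rewrite indicE; case: (_ \in _); rewrite ?expr1n ?expr0n.
have var n : r / 2 <= m n setT.
  have [_ -> _ _] := mP n; rewrite sqB.
  have h := variance_indic_dist (bA (k n)) (bB n) (BP n).2.
  have h1 : r / 2 * 2 ^- n <= r / 2.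
    rewrite -[leRHS]mulr1 ler_pM2l ?divr_gt0//.
    by rewrite invf_le1 ?exprn_gt0// exprn_ege1// ler1n.
  by have [_] := kP n; move: h h1; lra.
have r20 : 0 < r / 2 by rewrite divr_gt0.
have mT n : 0 < m n setT by exact: lt_le_trans (var n).
apply: (@amenable_of_almost_invariant_means R Gamma (fun n S => m n S / m n setT)).
- by move=> n S; have [h _ _ _] := mP n; rewrite divr_ge0.
- by move=> n; rewrite divff// gt_eqF.
- by move=> n S S' SS; have [_ _ h _] := mP n; rewrite h// mulrDl.
move=> g S e e0.
(* The bound of [walsh_mean] becomes d / (2t) + 2t with d = e r t / 8, that is 3 e r / 16. It has to
   be below e r / 2, since the total mass is at least r / 2. *)
pose t := e * r / 16.
have t0 : 0 < t by rewrite divr_gt0// mulr_gt0.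
pose d := e * r * t / 8.
have d0 : 0 < d by rewrite divr_gt0// !mulr_gt0.
have [N1 N1P] := Ainv g (d / 2) ltac:(by rewrite divr_gt0).
have rd : 0 < d / (2 * r) by rewrite divr_gt0// mulr_gt0.
have [N2 N2P] := half_power_lt rd.
exists (maxn N1 N2) => n; rewrite geq_max => /andP[N1n N2n].
have [_ _ _ /(_ g S t t0) h] := mP n.
rewrite -mulrBl normrM normfV (gtr0_norm (mT n)) ltr_pdivrMr//.
apply: (@lt_le_trans _ _ (e * (r / 2))); last by rewrite ler_pM2l.
apply: le_lt_trans h _.
have EB1 : E (fun x => \1_(B n) x ^+ 2 : R) <= 1.
  by rewrite sqB; have /andP[] := mean_indic_itv Q (bB n).
have disp : E (fun x => (\1_(B n) (act s_Gamma g x) - \1_(B n) x) ^+ 2 : R) < d.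
  (* The path from the translate of [B n] to [B n] passes through that of A (k n) and A (k n)
     itself, at costs d / 4, d / 2 and d / 4. *)
  apply: (@le_lt_trans _ _ (E (fun x =>
     `|\1_(A (k n)) (act s_Gamma g x) - \1_(B n) (act s_Gamma g x) : R|
     + `|\1_(A (k n)) (act s_Gamma g x) - \1_(A (k n)) x|
     + `|\1_(A (k n)) x - \1_(B n) x|))).
    apply: le_mean; try bounded.
    move=> x; apply: (@le_trans _ _ `|\1_(B n) (act s_Gamma g x) - \1_(B n) x|).
      rewrite !indicE; case: (_ \in _); case: (_ \in _);
        by rewrite /= ?subrr ?subr0 ?sub0r ?normrN ?normr1 ?normr0 ?sqrrN ?expr1n ?expr0n.
    rewrite (le_trans (ler_distD (\1_(A (k n)) (act s_Gamma g x)) _ _))//.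
    rewrite distrC -addrA lerD2l; exact: ler_distD.
  rewrite !meanD; try bounded.
  rewrite (mean_act (c := s_Gamma) g (f := fun x => `|\1_(A (k n)) x - \1_(B n) x : R|)); last by bounded.
  have h1 := (BP n).2.
  have h2 := N1P (k n) (leq_trans N1n (kP n).1).
  have h3 : r / 2 * 2 ^- n < d / 4.
    have h4 : 2 ^- n <= 2 ^- N2 :> R.
      by rewrite lef_pV2 ?posrE ?exprn_gt0// ler_weXn2l// ler1n.
    rewrite (_ : d / 4 = r / 2 * (d / (2 * r))); last by field; rewrite gt_eqF.
    by rewrite ltr_pM2l// (le_lt_trans h4).
  apply: (@lt_le_trans _ _ (d / 4 + d / 2 + d / 4)); last by lra.
  apply: ltr_leD; first by apply: ltrD => //; exact: le_lt_trans h1 h3.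
  exact: le_trans h1 (ltW h3).
apply: (@lt_le_trans _ _ (d / (2 * t) + t * 2)).
  apply: ltr_leD; first by rewrite ltr_pM2r// invr_gt0 mulr_gt0.
  by rewrite ler_pM2l//; lra.
rewrite (_ : d / (2 * t) = e * r / 16); last by rewrite /d; field; rewrite gt_eqF.
rewrite /t; nra.
Qed.

Lemma measurable_diagonal (a b : Gamma) :
  measurable [set x : Omega | sval (x a) = sval (x b)].
Proof.
have mF : measurable_fun setT (fun x : Omega => sval (x a) - sval (x b)).
  by apply: measurable_funB; exact: measurable_coordinate.
rewrite [X in measurable X](_ : _ = setT `&`
  (fun x : Omega => sval (x a) - sval (x b)) @^-1` [set 0]).
  exact: mF.
by rewrite setTI; apply/seteqP; split => x /=; 
  [move=> ->; rewrite subrr|move/eqP; rewrite subr_eq0 => /eqP].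
Qed.

(** Equal coordinates share their dyadic cell of order [n], which for two independent coordinates
    has probability 2 ^- n. *)
Lemma diagonal_null (a b : Gamma) : a != b ->
  Q [set x : Omega | sval (x a) = sval (x b)] = 0%E.
Proof.
move=> ab; have mD := measurable_diagonal a b; set D := [set x : Omega | _] in mD *.
have small n : fine (Q D) <= 1 * 2 ^- n.
  pose f h (x : Omega) := dyadic n (sval (x h)).
  have mf h : measurable_fun setT (f h).
    apply: (measurableT_comp (f := dyadic n)); first exact: measurable_dyadic.
    exact: measurable_coordinate.
  have mfi h i : measurable [set x | f h x = i].
    by rewrite -[X in measurable X]setTI; exact: (mf h measurableT [set i]).
  pose B := [set x : Omega | f b x = f a x].
  have mB : measurable B.
    rewrite (_ : B = \bigcup_i ([set x | f b x = i] `&` [set x | f a x = i])).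
      by apply: bigcupT_measurable => i; exact: measurableI.
    apply/seteqP; split => x /=; first by move=> xB; exists (f a x).
    by move=> [i _ [xb xa]]; rewrite /B /= xb xa.
  have QB : Q B = ((2 ^ n)%:R * (2 ^- n * 2 ^- n))%:E.
    rewrite (_ : B = [set x | (f a x < 2 ^ n)%N] `&` B); last first.
      by apply/seteqP; split => x /=; [rewrite dyadic_lt|case].
    apply: finite_level_prob => // i ilt.
    rewrite (_ : _ `&` _ = cylinder [:: a; b] (fun=> [set y : R | dyadic n y = i])).
      rewrite bernoulli_measureP//=; last first.
      - by move=> _; exact: measurable_dyadic_level.
      - by rewrite inE ab.
      rewrite !big_cons big_nil mulr1 -uniform01E.
        by rewrite dyadic_prob.
      exact: measurable_dyadic_level.
    apply/seteqP; split => x /=.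
      by move=> [xa xB] h; rewrite !inE => /orP[] /eqP->//; rewrite -xa -xB.
    move=> h; split; first by apply: h; rewrite mem_head.
    by rewrite /B /= /f !h// !inE eqxx ?orbT.
  rewrite mul1r; have -> : 2 ^- n = fine (Q B).
    by rewrite QB /= natrX mulrA divff ?mul1r// gt_eqF ?exprn_gt0.
  apply: fine_le; rewrite ?fin_num_measure//.
  by apply: le_measure; rewrite ?inE// => x xD; rewrite /B /= /f xD.
rewrite -[LHS]fineK ?fin_num_measure//; congr EFin.
apply/eqP; rewrite eq_le (le0_half_power small) /=.
exact/fine_ge0/measure_ge0.
Qed.

(** If g != 1 fixes a point, evaluating the shifted configuration at 1 shows that its coordinates at
    g^-1 and 1 agree; countably many null events cover this. *)
Lemma bernoulli_product_free (X : std_prob_space R) :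
  pmp_free (prod_action (identity_action Gamma X) s_Gamma).
Proof.
have /countable_injP[e einj] := Gcount.
have [v vK] := countable_retraction 1%g einj.
(* The event is empty at 1, a value that the enumeration [v] also takes. *)
pose D (g : Gamma) : set Omega :=
  if g == 1%g then set0 else [set x : Omega | sval (x g^-1%g) = sval (x 1%g)].
have D0 g : Q (D g) = 0%E /\ measurable (D g).
  rewrite /D; case: eqP => [_|/eqP g1]; first by rewrite measure0.
  split; last exact: measurable_diagonal.
  by apply: diagonal_null; rewrite invg_eq1.
apply: (@negligibleS _ _ _ _ (\bigcup_n ([set: X] `*` D (v n)))); last first.
  apply: negligible_bigcup => n; have [Dn mDn] := D0 (v n).
  apply/negligibleP; first exact: measurableX.
  by rewrite [LHS]product_measure1E// [X in (_ * X)%E]Dn mule0.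
move=> [y x] /= /existsNP[g /not_implyP[gx g1]].
exists (e g) => //; split => //=; rewrite vK /D (introF eqP)//=.
have : x (g^-1 * 1)%g = x 1%g by exact: (congr1 (fun z => z.2 1%g) gx).
by rewrite mulg1 => ->.
Qed.

End bernoulli_properties.

Theorem theorem1p3 (R : realType) (Gamma : groupType)
  (Gamma_countable : countable [set: Gamma])
  (X : std_prob_space R) (X_nonatomic : nonatomic X) :
  (forall b : pmp_action R Gamma, strongly_ergodic b ->
     forall c : pmp_action R Gamma, ergodic c ->
       ~ weakly_equivalent (prod_action (identity_action Gamma X) b) c) /\
  (~ amenable R Gamma ->
     pmp_free (prod_action (identity_action Gamma X)
                           (bernoulli_shift R Gamma_countable)) /\
     forall c : pmp_action R Gamma, ergodic c ->
       ~ weakly_equivalent (prod_action (identity_action Gamma X)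
                              (bernoulli_shift R Gamma_countable)) c).
Proof.
have main b (sb : strongly_ergodic b) c (ec : ergodic c) :=
  not_weakly_equivalent_ergodic Gamma_countable X_nonatomic sb ec.
split => // nonam; split; first exact: bernoulli_product_free.
exact: main (bernoulli_strongly_ergodic nonam).
Qed.
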